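(* Let $G=A*B$ be a finitely generated free product of two nontrivial groups $A$ and $B$. If $G$ is not isomorphic to $C_2*C_2$ or to $C_2*C_3$, then $\Omega(G)\geq\frac{1+\sqrt{5}}{2}$.
   Context: $C_k$ denotes the cyclic group of order $k$. For a group $G$ generated by a finite set $S$, the length $\ell_{G,S}(g)$ of $g\in G$ is the minimal integer $n\ge 0$ such that $g=x_1x_2\cdots x_n$ with all $x_i\in S\cup S^{-1}$. Let $F_{G,S}(n)$ be the number of $g\in G$ with $\ell_{G,S}(g)\le n$. The exponential growth rate of $G$ with respect to $S$ is $\omega(G,S)=\lim_{n\to\infty}(F_{G,S}(n))^{1/n}$ (the limit always exists). The minimal exponential growth rate is $\Omega(G)=\inf_S \omega(G,S)$, the infimum being over all finite generating sets $S$ of $G$. *)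

(* Defs.v *)
From HB Require Import structures.
From mathcomp Require Import all_boot all_order all_algebra finmap.
From mathcomp Require Import all_classical all_reals all_analysis.

Set Implicit Arguments.
Unset Strict Implicit.
Unset Printing Implicit Defensive.

Import Order.TTheory GRing.Theory Num.Theory.
Import numFieldNormedType.Exports.

Local Open Scope classical_set_scope.
Local Open Scope ring_scope.

(* Groups are [groupType]s of MathComp (boot/monoid.v), with no finiteness
   assumption.  Such a type carries a choice structure; classically every type
   has one, so this does not restrict the groups considered. *)

Definition nontrivial_group (G : groupType) : Prop := exists g : G, g <> 1%g.

Definition isomorphic_groups (G H : groupType) : Prop :=
  exists f : {multiplicative G -> H}, bijective f.

(* The multiplicative law of the group 'Z_k is addition modulo k. *)
Definition C2 : groupType := 'Z_2.
Definition C3 : groupType := 'Z_3.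

(* The free product A * B, realised as the group of reduced words: finite
   sequences of nontrivial letters coming alternately from A and from B.
   Multiplication concatenates and reduces.  [freeprod_lift] and
   [freeprod_lift_unique] below give its universal property. *)
Section FreeProduct.
Variables A B : groupType.
Implicit Types (x y z : A + B) (s t : seq (A + B)).

Definition letter_trivial x : bool :=
  match x with inl a => a == 1%g | inr b => b == 1%g end.

Definition letter_side x : bool := if x is inl _ then true else false.

Definition letter_mul x y : option (A + B) :=
  match x, y with
  | inl a, inl a' => Some (inl (a * a')%g)
  | inr b, inr b' => Some (inr (b * b')%g)
  | _, _ => None
  end.

Definition letter_inv x : A + B :=
  match x with inl a => inl (a^-1)%g | inr b => inr (b^-1)%g end.

Definition reduced s : bool :=
  all (fun x => ~~ letter_trivial x) s &&
  sorted (fun x y => letter_side x != letter_side y) s.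

(* Left multiplication of a reduced word by one letter. *)
Definition letter_act x s : seq (A + B) :=
  if letter_trivial x then s else
  match s with
  | [::] => [:: x]
  | y :: s' =>
      if letter_mul x y is Some z then
        if letter_trivial z then s' else z :: s'
      else x :: s
  end.

Lemma letter_mul_side x y :
  letter_side x = letter_side y -> exists z, letter_mul x y = Some z.
Proof. by case: x => ?; case: y => ? //= _; eexists. Qed.

Lemma reduced_tl x s : reduced (x :: s) -> reduced s.
Proof.
by move=> /andP[/= /andP[_ sn] sp]; rewrite /reduced sn (path_sorted sp).
Qed.

Lemma letter_act_reduced x s : reduced s -> reduced (letter_act x s).
Proof.
rewrite /letter_act; case: ifP => // nx.
case: s => [|y s] rs; first by rewrite /reduced /= nx.
have rs' := reduced_tl rs.
case E: (letter_mul x y) => [z|].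
  case: ifP => // nz; move: rs; rewrite /reduced /= nz /= => /andP[/andP[_ ->]] /=.
  suff e : letter_side z = letter_side y by case: (s) => //= ? ?; rewrite e.
  by move: E; case: (x) => ?; case: (y) => ? //= [<-].
move: rs; rewrite /reduced /= nx /= => /andP[-> ->]; rewrite andbT /=.
by move: E; case: (x); case: (y).
Qed.

Lemma letter_act_cons x s : reduced (x :: s) -> letter_act x s = x :: s.
Proof.
rewrite /reduced /= /letter_act => /andP[/andP[/negbTE -> _]].
by case: s => //= y s /andP[]; case: x; case: y.
Qed.

Lemma letter_actM x y z s :
  reduced s -> letter_mul x y = Some z ->
  letter_act x (letter_act y s) = letter_act z s.
Proof.
have triv1 u v w : letter_trivial u -> letter_mul u v = Some w -> w = v.
  by case: u => ?; case: v => ? //= /eqP-> [<-]; rewrite mul1g.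
have triv2 u v w : letter_trivial v -> letter_mul u v = Some w -> w = u.
  by case: u => ?; case: v => ? //= /eqP-> [<-]; rewrite mulg1.
move=> rs; have [tx|tx] := boolP (letter_trivial x).
  by move=> /(triv1 _ _ _ tx) ->; rewrite {1}/letter_act tx.
have [ty|ty] := boolP (letter_trivial y).
  by move=> /(triv2 _ _ _ ty) ->; rewrite [letter_act y s]/letter_act ty.
case: s rs => [_|t s rs]; last first.
  have [hty|] := altP (letter_side y =P letter_side t); last first.
    move=> hty hz; rewrite [letter_act y _]/letter_act (negbTE ty).
    have -> : letter_mul y t = None by case: (y) hty => ?; case: (t).
    rewrite {1}/letter_act (negbTE tx) hz /letter_act; case: ifP => // _.
    suff -> : letter_mul z t = None by [].
    by move: hz hty; case: (x) => ?; case: (y) => ? //=; case: (t) => ? // [<-].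
  have /andP[/= /andP[nt ns] ps] := rs.
  have act_s w : letter_side w = letter_side t ->
      letter_act w s = if letter_trivial w then s else w :: s.
    rewrite /letter_act; case: ifP => // _ hw.
    case: (s) ps => //= r s' /andP[+ _]; rewrite -hw.
    by case: (w); case: (r).
  case Eyt: (letter_mul y t) => [w|]; last first.
    by have [w] := letter_mul_side hty; rewrite Eyt.
  move=> hz.
  have hw : letter_side w = letter_side t.
    by move: hty Eyt; case: (y) => ?; case: (t) => ? //= _ [<-].
  have hx : letter_side x = letter_side t.
    by rewrite -hty; move: hz; case: (x); case: (y).
  have hzt : letter_side z = letter_side t.
    by rewrite -hty; move: hz; case: (x) => ?; case: (y) => ? //= [<-].
  have [v Ev] := letter_mul_side hzt.
  have hv : letter_mul x w = Some v.
    move: hz Eyt Ev; case: (x) => ?; case: (y) => ? //= [<-];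
    by case: (t) => ? //= [<-] [<-] /=; rewrite mulgA.
  rewrite [letter_act y _]/letter_act (negbTE ty) Eyt.
  rewrite [letter_act z _]/letter_act Ev.
  have -> : (if letter_trivial w then s else w :: s) = letter_act w s.
    by rewrite act_s.
  have [tw|tw] := boolP (letter_trivial w).
    have evx := triv2 _ _ _ tw hv; rewrite {2}/letter_act tw act_s // (negbTE tx).
    rewrite evx (negbTE tx); case: ifP => // tz.
    by rewrite -evx (triv1 _ _ _ tz Ev).
  rewrite (act_s w) // (negbTE tw) {1}/letter_act (negbTE tx) hv.
  by case: ifP => [tv|_]; case: ifP => // tz; have <- := triv1 _ _ _ tz Ev;
     rewrite ?tv //; move: nt; have <- := triv1 _ _ _ tz Ev; rewrite tv.
move=> hz; rewrite [letter_act y _]/letter_act (negbTE ty).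
by rewrite /letter_act (negbTE tx) hz.
Qed.

Definition word_mul s t : seq (A + B) := foldr letter_act t s.
Definition word_inv s : seq (A + B) := rev (map letter_inv s).

Lemma word_mul_reduced s t : reduced t -> reduced (word_mul s t).
Proof. by move=> rt; elim: s => //= x s; apply: letter_act_reduced. Qed.

Lemma word_inv_reduced s : reduced s -> reduced (word_inv s).
Proof.
rewrite /reduced /word_inv all_rev rev_sorted all_map => /andP[ns ss].
apply/andP; split.
  by apply: sub_all ns => -[?|?] /=; rewrite invg_eq1.
rewrite sorted_map; apply: sub_sorted ss => x y /=.
by case: x; case: y.
Qed.

Lemma word_mul_act x s t :
  reduced s -> reduced t ->
  word_mul (letter_act x s) t = letter_act x (word_mul s t).
Proof.
move=> rs rt; rewrite {1}/letter_act.
have [tx|tx] := boolP (letter_trivial x); first by rewrite {1}/letter_act tx.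
case: s rs => //= y s rs.
case E: (letter_mul x y) => [z|] //=.
rewrite (letter_actM _ E); last exact: word_mul_reduced.
by case: ifP => //= tz; rewrite [in RHS]/letter_act tz.
Qed.

Lemma word_mulA s t w :
  reduced t -> reduced w ->
  word_mul s (word_mul t w) = word_mul (word_mul s t) w.
Proof.
move=> rt rw; elim: s => //= x s IH.
by rewrite word_mul_act ?word_mul_reduced // -IH.
Qed.

Lemma word_muls0 s : reduced s -> word_mul s [::] = s.
Proof.
elim: s => //= x s IH rs; rewrite IH ?(reduced_tl rs) //.
exact: letter_act_cons.
Qed.

Lemma word_mulVs s : reduced s -> word_mul (word_inv s) s = [::].
Proof.
elim: s => //= x s IH rs; rewrite /word_inv /= rev_cons /word_mul foldr_rcons.
have -> : letter_act (letter_inv x) (x :: s) = s.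
  have /andP[/= /andP[nx _] _] := rs.
  rewrite /letter_act; case: (x) nx => a /= /negbTE;
  by rewrite invg_eq1 => ->; rewrite mulVg eqxx.
exact: IH (reduced_tl rs).
Qed.

Lemma word_invK : involutive word_inv.
Proof.
move=> s; rewrite /word_inv map_rev revK -map_comp map_id_in //.
by move=> [a|b] _ /=; rewrite invgK.
Qed.

Record freeprod : Type :=
  FreeProd { freeprod_word :> seq (A + B); _ : reduced freeprod_word }.

HB.instance Definition _ := [isSub for freeprod_word].
HB.instance Definition _ := [Choice of freeprod by <:].

Implicit Types u v w : freeprod.

Definition freeprod_one : freeprod := @FreeProd [::] isT.
Definition freeprod_mul u v : freeprod :=
  FreeProd (word_mul_reduced u (valP v)).
Definition freeprod_inv u : freeprod := FreeProd (word_inv_reduced (valP u)).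

Lemma freeprod_mulA : associative freeprod_mul.
Proof. by move=> u v w; apply: val_inj; apply: word_mulA; apply: valP. Qed.

Lemma freeprod_mul1 : left_id freeprod_one freeprod_mul.
Proof. by move=> u; apply: val_inj. Qed.

Lemma freeprod_mulr1 : right_id freeprod_one freeprod_mul.
Proof. by move=> u; apply: val_inj; apply: word_muls0; apply: valP. Qed.

Lemma freeprod_mulV : left_inverse freeprod_one freeprod_inv freeprod_mul.
Proof. by move=> u; apply: val_inj; apply: word_mulVs; apply: valP. Qed.

Lemma freeprod_mulrV : right_inverse freeprod_one freeprod_inv freeprod_mul.
Proof.
move=> u; have {1}-> : u = freeprod_inv (freeprod_inv u).
  by apply: val_inj; rewrite /= word_invK.
exact: freeprod_mulV.
Qed.

HB.instance Definition _ := isGroup.Build freeprod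
  freeprod_mulA freeprod_mul1 freeprod_mulr1 freeprod_mulV freeprod_mulrV.

Lemma val_freeprodM u v : val (u * v)%g = word_mul (val u) (val v).
Proof. by []. Qed.

Lemma letter_word_reduced x : reduced (letter_act x [::]).
Proof. exact: letter_act_reduced. Qed.

Definition freeprod_letter x : freeprod := FreeProd (letter_word_reduced x).
Definition freeprod_inl (a : A) : freeprod := freeprod_letter (inl a).
Definition freeprod_inr (b : B) : freeprod := freeprod_letter (inr b).

Lemma freeprod_letterM x y z :
  letter_mul x y = Some z ->
  freeprod_letter z = (freeprod_letter x * freeprod_letter y)%g.
Proof.
move=> E; apply: val_inj.
by rewrite val_freeprodM word_mul_act ?letter_word_reduced //= (letter_actM _ E).
Qed.

Lemma freeprod_inlM : {morph freeprod_inl : a a' / (a * a')%g}.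
Proof. by move=> a a'; apply: freeprod_letterM. Qed.

Lemma freeprod_inrM : {morph freeprod_inr : b b' / (b * b')%g}.
Proof. by move=> b b'; apply: freeprod_letterM. Qed.

HB.instance Definition _ :=
  isMultiplicative.Build A freeprod freeprod_inl freeprod_inlM.
HB.instance Definition _ :=
  isMultiplicative.Build B freeprod freeprod_inr freeprod_inrM.

Lemma freeprodE u : u = (\prod_(x <- val u) freeprod_letter x)%g.
Proof.
apply: val_inj; case: u => s /= rs.
elim: s rs => [|x s IH] rs; first by rewrite big_nil.
have rs' := reduced_tl rs.
rewrite big_cons.
set p := (\prod_(y <- s) _)%g; have {}IH : s = val p by exact: IH.
by rewrite val_freeprodM -IH word_mul_act //= letter_act_cons.
Qed.

Section Lift.
Variables (H : groupType) (f : {multiplicative A -> H}).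
Variable (g : {multiplicative B -> H}).

Let ev x : H := match x with inl a => f a | inr b => g b end.

Let hom1 (K : groupType) (h : {multiplicative K -> H}) : h 1%g = 1%g.
Proof. by apply: (@mulgI _ (h 1%g)); rewrite -gmulfM !mulg1. Qed.

Let ev_trivial x : letter_trivial x -> ev x = 1%g.
Proof. by case: x => a /= /eqP ->; apply: hom1. Qed.

Let lift_act x s :
  (\prod_(y <- letter_act x s) ev y = ev x * \prod_(y <- s) ev y)%g.
Proof.
rewrite /letter_act; case: ifP => [/ev_trivial->|_]; first by rewrite mul1g.
case: s => [|y s]; first by rewrite big_cons.
rewrite !big_cons mulgA; case E: (letter_mul x y) => [z|]; last first.
  by rewrite !big_cons mulgA.
have -> : (ev x * ev y)%g = ev z.
  by case: x E => a; case: y => b //= [<-] /=; rewrite gmulfM.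
by case: ifP => [/ev_trivial->|_]; rewrite ?mul1g // big_cons.
Qed.

Lemma freeprod_lift : exists h : {multiplicative freeprod -> H},
  (forall a, h (freeprod_inl a) = f a) /\ (forall b, h (freeprod_inr b) = g b).
Proof.
pose h u : H := (\prod_(x <- val u) ev x)%g.
have hM : {morph h : u v / (u * v)%g}.
  move=> u v; rewrite /h val_freeprodM.
  elim: {u}(val u) => [|x s IH] /=; first by rewrite big_nil mul1g.
  by rewrite lift_act IH big_cons mulgA.
pose hh : {multiplicative freeprod -> H} :=
  HB.pack h (isMultiplicative.Build freeprod H h hM).
exists hh; split=> a; rewrite /= /h /= lift_act big_nil mulg1 //.
Qed.

Lemma freeprod_lift_unique (h k : {multiplicative freeprod -> H}) :
  (forall a, h (freeprod_inl a) = k (freeprod_inl a)) ->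
  (forall b, h (freeprod_inr b) = k (freeprod_inr b)) ->
  forall u, h u = k u.
Proof.
move=> hk1 hk2 u; rewrite (freeprodE u).
elim: (val u) => [|x s IH]; first by rewrite !big_nil !hom1.
by rewrite !big_cons !gmulfM IH; case: x => a; congr (_ * _)%g; rewrite ?hk1 ?hk2.
Qed.

End Lift.
End FreeProduct.

Section Growth.
Variable G : groupType.
Implicit Types (S : {fset G}) (g : G) (n : nat).

Definition expressible S g n : Prop := exists s : seq G,
  [/\ size s = n, forall x, x \in s -> (x \in S) \/ ((x^-1)%g \in S)
    & g = (\prod_(x <- s) x)%g].

Definition generates S : Prop := forall g, exists n, expressible S g n.

(* The default value 0 is only taken on elements outside the subgroup
   generated by S, hence never when S generates G. *)
Definition word_length S g : nat :=
  if pselect (exists n, `[< expressible S g n >]) is left h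
  then ex_minn h else 0.

Definition ball S n : set G := [set g | (word_length S g <= n)%N].

(* [fset_set] is meaningful on finite sets only: see [ball_finite]. *)
Definition growth S n : nat := #|` fset_set (ball S n)|.

Lemma word_lengthP S g : generates S ->
  expressible S g (word_length S g) /\
  forall n, expressible S g n -> (word_length S g <= n)%N.
Proof.
move=> genS; rewrite /word_length; case: pselect => [h|[]]; last first.
  by have [n ?] := genS g; exists n; apply/asboolP.
by case: ex_minnP => m /asboolP hm hmin; split=> // n /asboolP /hmin.
Qed.

Lemma ball_finite S n : generates S -> finite_set (ball S n).
Proof.
move=> genS.
pose T := [fset x | x in enum_fset S ++ [seq (x^-1)%g | x <- enum_fset S]]%fset.
have step m : finite_set [set g | expressible S g m].
  elim: m => [|m IH].
    apply: (sub_finite_set _ (finite_set1 (1%g : G))) => g [s [/size0nil-> _ ->]] /=.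
    by rewrite big_nil.
  apply: (sub_finite_set _ (finite_image2 (fun x y : G => (x * y)%g)
    (finite_fset T) IH)) => g [[|x s] [// [sz] hs ->]].
  rewrite big_cons; exists x; last first.
    exists (\prod_(y <- s) y)%g => //; exists s; split=> // y ys.
    by apply: hs; rewrite inE ys orbT.
  have := hs x (mem_head _ _); rewrite /T /= !inE => -[->//|xS].
  by apply/orP; right; apply/mapP; exists (x^-1)%g; rewrite ?invgK.
apply: (sub_finite_set _ (bigcup_finite (finite_II n.+1) (fun m _ => step m))).
move=> g gn; exists (word_length S g) => //=.
by have [] := word_lengthP g genS.
Qed.

End Growth.

Definition finitely_generated (G : groupType) : Prop :=
  exists S : {fset G}, generates S.

(* The index n = 0 (where 1/n is read as 0) does not affect the limit. *)
Definition growth_rate (R : realType) (G : groupType) (S : {fset G}) : R :=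
  lim ((growth S n)%:R `^ (n%:R^-1) @[n --> \oo]).

Definition minimal_growth_rate (R : realType) (G : groupType) : R :=
  inf [set growth_rate R S | S in [set S : {fset G} | generates S]].

(* Main.v *)
Require Import Defs.
From HB Require Import structures.
From mathcomp Require Import all_boot all_order all_algebra finmap.
From mathcomp Require Import all_classical all_reals all_analysis.
From mathcomp Require Import ring zify.

Set Implicit Arguments.
Unset Strict Implicit.
Unset Printing Implicit Defensive.

Import Order.TTheory GRing.Theory Num.Theory.
Import numFieldNormedType.Exports.

Local Open Scope group_scope.

(**
  Let [phi] be the golden ratio, so that 1/phi + 1/phi^2 = 1.  The balls of a
  generating set [S] grow at least like [phi^n] as soon as the group contains
  a free monoid on two elements of lengths 1 and 2, or on three elements of
  lengths 2, 2 and 3, since 2/phi^2 + 1/phi^3 = 1; more generally, it suffices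
  to map injectively into the group the paths of a weighted graph whose transfer
  operator has a positive subsolution at [phi] ([golden_paths]).  The growth
  rate is a limit by Fekete's lemma ([submultiplicative_root_cvg]), hence the
  theorem follows if every generating set contains such a configuration
  ([golden_generating_set]).

  [A * B] acts on its Bass-Serre tree with trivial edge stabilizers.  The edges
  of the tree are the elements of the group, and the two half-trees bounded by
  the edge 1 consist of the reduced words that start on a given side.  So the
  geometry of the tree is about first letters and prefixes of reduced words, and
  freeness is always proved by ping-pong on half-trees ([ping_pong]).

  Suppose first that some [s] in [S] is hyperbolic.  If all of [S] preserves the
  axis of [s], both vertex groups have order 2 ([normal_axis_dihedral]), which
  is excluded.  Otherwise some [t] in [S] moves the axis, and [s] together with
  [s t] or [s t^-1] generates a free monoid, up to inverting [s].  There is one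
  exception: [t] may be an involution that fixes a vertex of the axis and
  exchanges the two directions of the axis there.  Then [s] and [t s^-1 t] are
  free, and changing between them costs one extra letter, which leads to the same
  number [phi] ([hyperbolic_good], [golden_switch]).

  Otherwise every generator fixes exactly one vertex.  If all generators are
  involutions, there are three of them that do not generate a dihedral group, and
  some edge separates the vertex of one of them, [K], from those of the others,
  [X] and [W].  Then [X K], [W K] and [X W K] are free ([involutive_triple]).
  This is clear if the paths to [X] and [W] diverge.  If the path to [W] runs
  through the vertex of [X] and is folded by [X], replacing [W] by [X W X]
  shortens it, and the three products change by a Nielsen move, as in the
  Euclidean algorithm.

  If some generator [X] is not an involution, each of the following yields a short
  free triple at once: a generator with the same vertex other than [X] and its
  inverse, order greater than 3, or a generator of order at least 3 with another
  vertex.  What remains is [X] of order 3 and involutions with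
  other vertices.  If there is only one, the group is [C2 * C3].  For two
  involutions [Y] and [Z] with [X] between them, the gaps in the words
  [Y . Z . Y . Z ...] can be filled in two ways each ([golden_between]).  With
  [X] at an end, foldings are used again ([mixed_triple]).  Now they may end with
  [Y = Z], when the group generated by the three elements is [C2 * C3] with a
  redundant generating set; but then one of three products of length 2 is a word
  in the other two, and saving letters by this word is again worth [phi]
  ([semifree], [golden_semifree]).
*)

(** * Free families and the ping-pong criterion *)

Section FreeFamilies.
Variable G : groupType.
Implicit Types a b c h : G.

Definition eval (L : Type) (f : L -> G) (w : seq L) : G := \prod_(l <- w) f l.

(** The family freely generates a free submonoid of the group. *)
Definition free_family (L : Type) (f : L -> G) : Prop := injective (eval f).

Lemma eval_nil (L : Type) (f : L -> G) : eval f [::] = 1.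
Proof. by rewrite /eval big_nil. Qed.

Lemma eval_cons (L : Type) (f : L -> G) l w : eval f (l :: w) = f l * eval f w.
Proof. by rewrite /eval big_cons. Qed.

Lemma eval_cat (L : Type) (f : L -> G) v w :
  eval f (v ++ w) = eval f v * eval f w.
Proof. by rewrite /eval big_cat. Qed.

Lemma eval_rcons (L : Type) (f : L -> G) w l :
  eval f (rcons w l) = eval f w * f l.
Proof. by rewrite -cats1 eval_cat eval_cons eval_nil mulg1. Qed.

Lemma eval_flatten (L L' : Type) (f : L -> G) (t : L' -> seq L) w :
  eval f (flatten (map t w)) = eval (fun l => eval f (t l)) w.
Proof.
by elim: w => [|l w IH] /=; rewrite ?eval_nil // eval_cat IH eval_cons.
Qed.

Lemma eval_ext (L : Type) (f f' : L -> G) : f =1 f' -> eval f =1 eval f'.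
Proof. by move=> ff' w; apply: eq_bigr => l _. Qed.

Lemma free_conj (L : Type) (f f' : L -> G) h :
  (forall l, f' l = h * f l * h^-1) -> free_family f -> free_family f'.
Proof.
move=> ff' fF v w; have ev u : eval f' u = h * eval f u * h^-1.
  elim: u => [|l u IH]; first by rewrite !eval_nil mulg1 mulgV.
  by rewrite !eval_cons IH ff' !mulgA mulgVK.
by rewrite !ev => /mulIg/mulgI/fF.
Qed.

Lemma free_inv (L : Type) (f f' : L -> G) :
  (forall l, f' l = (f l)^-1) -> free_family f -> free_family f'.
Proof.
move=> ff' fF v w; have ev u : eval f' u = (eval f (rev u))^-1.
  elim: u => [|l u IH]; first by rewrite !eval_nil invg1.
  by rewrite eval_cons IH rev_cons eval_rcons invgM ff'.
by rewrite !ev => /invg_inj/fF /(can_inj revK).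
Qed.

Lemma free_subst (L L' : Type) (f : L -> G) (f' : L' -> G) (t : L' -> seq L) :
  (forall l, f' l = eval f (t l)) ->
  injective (fun w => flatten (map t w)) -> free_family f -> free_family f'.
Proof.
move=> ff' tI fF v w.
by rewrite !(eval_ext ff') -!eval_flatten => /fF/tI.
Qed.

Lemma free_reindex (L L' : Type) (f : L -> G) (f' : L' -> G) (p : L' -> L) :
  (forall l, f' l = f (p l)) -> injective p -> free_family f -> free_family f'.
Proof.
move=> ff' pI; apply: (@free_subst _ _ _ _ (fun l => [:: p l])).
  by move=> l; rewrite eval_cons eval_nil mulg1.
have E u : flatten [seq [:: p l] | l <- u] = map p u by elim: u => //= l u ->.
by move=> v w; rewrite !E => /(inj_map pI).
Qed.

(** Freeness survives the positive Nielsen moves: in a word over the new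
    letters, an [i] followed by a [j] of the old alphabet can only come from
    the new [j]. *)
Lemma free_mull (L : eqType) (f f' : L -> G) i j : i != j ->
  f' j = f i * f j -> (forall l, l != j -> f' l = f l) ->
  free_family f -> free_family f'.
Proof.
move=> ij f'j f'l; pose t l := if l == j then [:: i; j] else [:: l].
apply: (@free_subst _ _ _ _ t).
  move=> l; rewrite /t; case: eqP => [->|/eqP lj].
    by rewrite !eval_cons eval_nil mulg1.
  by rewrite eval_cons eval_nil mulg1 f'l.
have nj s w : flatten (map t w) <> j :: s.
  case: w => //= l w; rewrite /t; case: eqP => [_ [] /eqP|lj []//].
  by rewrite (negPf ij).
elim=> [|l v IH] [|l' w] //=; rewrite /t.
- by case: ifP.
- by case: ifP.
case: eqP => [->|lj]; case: eqP => [->|lj'] //=.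
- by move=> [/IH->].
- by move=> [<-] e; case: (nj _ _ (esym e)).
- by move=> [->] /nj.
- by move=> [-> /IH->].
Qed.

Lemma free_mulr (L : eqType) (f f' : L -> G) i j : i != j ->
  f' j = f j * f i -> (forall l, l != j -> f' l = f l) ->
  free_family f -> free_family f'.
Proof.
move=> ij f'j f'l fF.
apply: (@free_inv _ (fun l => (f' l)^-1)) => [l|]; first by rewrite invgK.
have: free_family (fun l => (f l)^-1) by apply: free_inv fF.
apply: (free_mull ij) => [|l lj]; first by rewrite f'j invgM.
by rewrite f'l.
Qed.

(** Ping-pong for submonoids: every nonempty word maps the domain into the
    image of its first letter.  A nonempty word is not the identity, because
    the image of any other letter is missed. *)
Lemma ping_pong (L : eqType) (f : L -> G) (D : G -> Prop) :
  (exists h, D h) -> (forall l : L, exists l', l' != l) ->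
  (forall l h, D h -> D (f l * h)) ->
  (forall l l' h h', D h -> D h' -> f l * h = f l' * h' -> l = l') ->
  free_family f.
Proof.
move=> [h0 Dh0] other stab disj.
have Dw w h : D h -> D (eval f w * h).
  elim: w => [|l w IH] Dh; first by rewrite eval_nil mul1g.
  by rewrite eval_cons -mulgA; apply: stab; apply: IH.
have n1 l w : eval f (l :: w) <> 1.
  move=> e; have [l' /eqP ll'] := other l; apply: ll'.
  apply: (disj _ _ h0 (eval f w * (f l' * h0))) => //.
    by apply: Dw; apply: stab.
  by rewrite !mulgA -eval_cons e mul1g.
elim=> [|l v IH] [|l' w] //.
- by rewrite eval_nil => /esym/n1.
- by rewrite eval_nil => /n1.
move=> e; have ll' : l = l'.
  apply: (disj _ _ (eval f v * h0) (eval f w * h0)); [exact: Dw..|].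
  by rewrite !mulgA -!eval_cons e.
by move: e; rewrite -ll' !eval_cons => /mulgI/IH->.
Qed.

Definition duo a b (l : bool) : G := if l then a else b.

Definition tri a b c (l : option bool) : G :=
  if l is Some l' then duo a b l' else c.

End FreeFamilies.

(** * Words in two letters *)

Lemma shift_constant (d : bool) (V s s' : seq bool) :
  V ++ s = d :: V ++ s' -> all (pred1 d) V.
Proof.
by elim: V d => //= v V IH d [-> /IH->]; rewrite eqxx.
Qed.

Lemma two_letters_not_constant (d : bool) (V : seq bool) :
  true \in V -> false \in V -> ~~ all (pred1 d) V.
Proof.
by move=> tV fV; apply/negP => /allP aV; move: (aV _ tV) (aV _ fV); case: d {aV}.
Qed.

(** The words [V ++ x l] form a code as soon as distinct tails [x l] diverge
    or differ by one appended letter: in the second case the next occurrence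
    of [V] would overlap itself with a shift of one. *)
Lemma common_prefix_code (L : eqType) (V : seq bool) (x : L -> seq bool) :
  true \in V -> false \in V ->
  (forall l l' s s', l != l' -> x l ++ s = x l' ++ s' ->
     exists d, s = d :: s' \/ s' = d :: s) ->
  injective (fun w => flatten [seq V ++ x l | l <- w]).
Proof.
move=> tV fV xP.
have nz s : V ++ s <> [::] by case: (V) tV.
have key d v w : flatten [seq V ++ x l | l <- v] <>
                 d :: flatten [seq V ++ x l | l <- w].
  move=> e; have /negP[] := two_letters_not_constant d tV fV.
  case: v e => //= l v; case: w => [|l' w] /=; last first.
    by rewrite -!catA => /shift_constant.
  by rewrite -catA; case: (V) => [|b [|? ?]] //= [->]; rewrite eqxx.
elim=> [|l v IH] [|l' w] //=.
- by rewrite -catA => /esym/nz.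
- by rewrite -catA => /nz.
rewrite -!catA => /(congr1 (drop (size V))); rewrite !drop_size_cat // => e.
have [ll'|ll'] := eqVneq l l'.
  move: e; rewrite -ll' => /(congr1 (drop (size (x l)))).
  by rewrite !drop_size_cat // => /IH->.
by have [d [/key|/key]] := xP _ _ _ _ ll' e.
Qed.

Lemma common_suffix_code (L : eqType) (V : seq bool) (x : L -> seq bool) :
  true \in V -> false \in V ->
  (forall l l' s s', l != l' -> rev (x l) ++ s = rev (x l') ++ s' ->
     exists d, s = d :: s' \/ s' = d :: s) ->
  injective (fun w => flatten [seq x l ++ V | l <- w]).
Proof.
move=> tV fV xP v w e; apply: (can_inj revK).
apply: (@common_prefix_code _ (rev V) (fun l => rev (x l))); rewrite ?mem_rev //.
have E u : flatten [seq rev V ++ rev (x l) | l <- rev u] =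
           rev (flatten [seq x l ++ V | l <- u]).
  elim: u => //= l u IH.
  by rewrite rev_cons map_rcons flatten_rcons IH !rev_cat catA.
by rewrite !E e.
Qed.

Definition with_word (W : seq bool) (l : option bool) : seq bool :=
  if l is Some b then [:: b] else W.

Definition avoids (f : bool) (x y : option bool) : bool :=
  ~~ ((x == Some f) && (y == Some (~~ f))).

(** If [W] starts with the run [f^i] followed by the other letter [g], a word
    that spells the factor [f g] only inside copies of [W] is determined by
    its expansion: the first [g] ends a copy of [W]'s initial run, and there is
    only one place where this copy can start. *)
Lemma with_word_inj (f : bool) i W' v w :
  let W := nseq i.+1 f ++ ~~ f :: W' in
  sorted (avoids f) v -> sorted (avoids f) w ->
  flatten (map (with_word W) v) = flatten (map (with_word W) w) -> v = w.
Proof.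
move=> W.
have nf b : (b == ~~ b) = false by case: b.
have nf' b : (~~ b == b) = false by case: b.
have run k : (k < i.+1)%N -> forall w r, path (avoids f) (Some f) w ->
    nseq k f ++ ~~ f :: r <> flatten (map (with_word W) w).
  elim: k => [|k IH] ki [|[b|] u] r //=.
  - by rewrite /avoids eqxx /= => /andP[/eqP nb _] [eb _]; apply: nb; rewrite eb.
  - by move=> _ [] /eqP; rewrite nf'.
  - by move=> /andP[_ pu] [eb]; rewrite -eb in pu; apply: IH => //; apply: ltnW.
  - move=> _ [] /(congr1 (fun s => nth f s k)).
    rewrite nth_cat size_nseq ltnn subnn /= -catA nth_cat size_nseq.
    by rewrite -ltnS ki nth_nseq -ltnS ki => /eqP; rewrite nf'.
elim: v w => [|x v IH] [|y w] //=.
- by case: y => // b.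
- by case: x => // b.
have sp z u : path (avoids f) z u -> sorted (avoids f) u by exact: path_sorted.
move=> pv pw; have [<-|xy] := eqVneq x y.
  by move=> e; rewrite (IH w) ?(sp _ _ pv) ?(sp _ _ pw) //;
     move: e; case: (x) => [b [//]|/(congr1 (drop (size W)))] /=;
     rewrite -/(W) !drop_size_cat.
case: x y pv pw xy => [b|] [b'|] //= pv pw.
- by move=> bb' [eb]; rewrite eb eqxx in bb'.
- move=> _ [eb]; rewrite eb in pv; rewrite -catA => /esym e.
  by case: (run i (ltnSn i) v _ pv e).
- move=> _ [eb]; rewrite -eb in pw; rewrite -catA => e.
  by case: (run i (ltnSn i) w _ pw e).
Qed.

(** * Triples generating almost free monoids *)

Section Semifree.
Variable G : groupType.
Implicit Types a b c h : G.

(** In the second case [c] is redundant, but as a generator it replaces a product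
    of at least two factors; as [W] uses both letters, it is not a power of one
    of them. *)
Definition semifree a b c : Prop :=
  free_family (tri a b c) \/
  free_family (duo a b) /\
  exists W, [/\ true \in W, false \in W & c = eval (duo a b) W].

Lemma eval_duo_swap a b W : eval (duo b a) W = eval (duo a b) (map negb W).
Proof. by elim: W => [|[] W IH]; rewrite ?eval_nil //= !eval_cons IH. Qed.

Lemma semifree_swap a b c : semifree a b c -> semifree b a c.
Proof.
case=> [F|[F [W [tW fW ->]]]]; [left|right; split].
- apply: (free_reindex (p := omap negb)) F; first by case=> [[]|].
  by case=> [[]|] [[]|].
- by apply: (free_reindex (p := negb)) F => [[]|[] []].
exists (map negb W); split; [by apply/mapP; exists false| |].
  by apply/mapP; exists true.
exact: eval_duo_swap.
Qed.

Lemma semifree_conj a b c h :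
  semifree a b c -> semifree (h * a * h^-1) (h * b * h^-1) (h * c * h^-1).
Proof.
case=> [F|[F [W [tW fW ->]]]]; [left|right; split].
- by apply: free_conj F => -[[]|].
- by apply: free_conj F => -[].
exists W; split=> //; elim: W {tW fW} => [|l W IH].
  by rewrite !eval_nil mulg1 mulgV.
by rewrite !eval_cons -IH; case: l => /=; rewrite !mulgA mulgVK.
Qed.

Lemma semifree_inv a b c : semifree a b c -> semifree a^-1 b^-1 c^-1.
Proof.
case=> [F|[F [W [tW fW ->]]]]; [left|right; split].
- by apply: free_inv F => -[[]|].
- by apply: free_inv F => -[].
exists (rev W); rewrite !mem_rev; split=> //; elim: W {tW fW} => [|l W IH].
  by rewrite !eval_nil invg1.
by rewrite rev_cons eval_rcons eval_cons invgM IH; case: l.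
Qed.

Lemma semifree_mid a b c : semifree a b c -> semifree a b (a * c * b).
Proof.
case=> [F|[F [W [tW fW ->]]]]; [left|right; split=> //].
- apply: (@free_mull _ _ (tri a b (c * b)) _ (Some true) None) => //=.
    by rewrite mulgA.
  by case=> [[]|].
  by apply: (@free_mulr _ _ (tri a b c) _ (Some false) None) F => //= -[[]|].
exists (true :: rcons W false); rewrite !inE !mem_rcons !inE /=; split=> //.
by rewrite eval_cons eval_rcons mulgA.
Qed.

Lemma semifree_code (t : option bool -> seq bool) a b a' b' c' :
  a' = eval (duo a b) (t (Some true)) -> b' = eval (duo a b) (t (Some false)) ->
  c' = eval (duo a b) (t None) -> injective (fun w => flatten (map t w)) ->
  free_family (duo a b) -> semifree a' b' c'.
Proof.
by move=> ea eb ec tI F; left; apply: (free_subst (t := t)) F => // -[[]|].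
Qed.

(** If [c] is the word [W], the three products are [W] followed by one letter
    or none, and all three become free. *)
Lemma semifree_pre a b c : semifree a b c -> semifree (c * b) (c * a) c.
Proof.
case=> [F|[F [W [tW fW ->]]]].
  left; apply: (@free_mull _ _ (tri (c * b) a c) _ None (Some false)) => //=.
    by case=> [[]|].
  apply: (@free_mull _ _ (tri b a c) _ None (Some true)) => //=.
    by case=> [[]|].
  apply: (free_reindex (p := omap negb)) F; first by case=> [[]|].
  by case=> [[]|] [[]|].
pose x (l : option bool) := if l is Some d then [:: ~~ d] else [::].
apply: (@semifree_code (fun l => W ++ x l)) F.
- by rewrite eval_cat eval_cons eval_nil mulg1.
- by rewrite eval_cat eval_cons eval_nil mulg1.
- by rewrite cats0.
by apply: common_prefix_code => // -[[]|] [[]|] //= s s' _ //;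
   [move=> <-|move=> <-|move=> ->|move=> ->];
   by [exists false; right|exists true; right|exists false; left|exists true; left].
Qed.

(** If [c] is the word [W], the three products end with [W], which again makes
    them free. *)
Lemma semifree_post a b c :
  semifree a b c -> semifree (a * c) (b * c) (a * (b * c)).
Proof.
case=> [F|[F [W [tW fW ->]]]].
  pose p (l : option bool) :=
    if l is Some true then None else if l is None then Some true else l.
  left; apply: (@free_reindex _ _ _ (tri (a * (b * c)) (b * c) (a * c)) _ p).
  - by case=> [[]|].
  - by case=> [[]|] [[]|].
  apply: (@free_mulr _ _ (tri a (b * c) (a * c)) _ (Some false) (Some true)) => //=.
    by case=> [[]|].
  apply: (@free_mull _ _ (tri a (b * c) c) _ (Some true) None) => //=.
    by case=> [[]|].
  apply: (@free_mulr _ _ (tri a b c) _ None (Some false)) F => //=.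
  by case=> [[]|].
pose x (l : option bool) := if l is Some d then [:: d] else [:: true; false].
apply: (@semifree_code (fun l => x l ++ W)) F.
- by rewrite eval_cat eval_cons eval_nil mulg1.
- by rewrite eval_cat eval_cons eval_nil mulg1.
- by rewrite eval_cat !eval_cons eval_nil mulg1 mulgA.
apply: common_suffix_code => // -[[]|] [[]|] /=; rewrite /rev /= => s s' _ // [e].
- by exists true; left.
- by exists true; right.

Qed.
End Semifree.

(** * Reduced words *)

Section Words.
Variables A B : groupType.
Local Arguments reduced : simpl never.
Local Notation G := (freeprod A B).
Local Notation T := (A + B)%type.
Local Notation lt := (@freeprod_letter A B).
Local Notation side := (@letter_side A B).
Local Notation linv := (@letter_inv A B).
Implicit Types (x y z c : T) (s t w : seq T) (g h : G) (o : bool).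

Lemma letter_invK : involutive linv.
Proof. by case=> a /=; rewrite invgK. Qed.

Lemma letter_side_inv x : side (linv x) = side x.
Proof. by case: x. Qed.

Lemma letter_trivial_inv x : letter_trivial (linv x) = letter_trivial x.
Proof. by case: x => a /=; rewrite invg_eq1. Qed.

Lemma freeprod_letter_trivial x : letter_trivial x -> lt x = 1.
Proof. by move=> tx; apply: val_inj; rewrite /= /letter_act tx. Qed.

Lemma freeprod_letterV x : lt (linv x) = (lt x)^-1.
Proof.
apply: (@mulgI _ (lt x)); rewrite mulgV.
have [z [e tz]] : exists z, letter_mul x (linv x) = Some z /\ letter_trivial z.
  by case: x => a /=; eexists; split; [reflexivity|rewrite /= mulgV eqxx|
     reflexivity|rewrite /= mulgV eqxx].
by rewrite -(freeprod_letterM e) freeprod_letter_trivial.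
Qed.

Lemma letter_merge x y : side x = side y -> exists z,
  [/\ side z = side x, lt x * lt y = lt z,
      letter_trivial z -> x = linv y, (z = y -> letter_trivial x)
    & (z = x -> letter_trivial y)].
Proof.
case: x => a; case: y => b //= _; [exists (inl (a * b))|exists (inr (a * b))];
  split=> //=.
- by apply/esym/freeprod_letterM.
- by rewrite mulg_eq1 => /eqP->.
- by case=> /(canRL (mulgK _)); rewrite mulgV => /eqP.
- by case=> /(canRL (mulKg _)); rewrite mulVg => /eqP.
- by apply/esym/freeprod_letterM.
- by rewrite mulg_eq1 => /eqP->.
- by case=> /(canRL (mulgK _)); rewrite mulgV => /eqP.
- by case=> /(canRL (mulKg _)); rewrite mulVg => /eqP.
Qed.

Definition starts o w : bool := if w is x :: _ then side x == o else false.

Definition elt w : G := \prod_(x <- w) lt x.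

Lemma elt_nil : elt [::] = 1. Proof. by rewrite /elt big_nil. Qed.
Lemma elt_cons x w : elt (x :: w) = lt x * elt w.
Proof. by rewrite /elt big_cons. Qed.
Lemma elt1 x : elt [:: x] = lt x. Proof. by rewrite /elt big_seq1. Qed.
Lemma elt_cat s t : elt (s ++ t) = elt s * elt t.
Proof. by rewrite /elt big_cat. Qed.
Lemma elt_val g : elt (val g) = g. Proof. by rewrite [RHS]freeprodE. Qed.
Lemma val_elt w : reduced w -> val (elt w) = w.
Proof. by move=> rw; rewrite -[elt w]/(elt (val (FreeProd rw))) elt_val. Qed.

Lemma eltV w : elt (word_inv w) = (elt w)^-1.
Proof.
elim: w => [|x w IH]; first by rewrite elt_nil invg1.
rewrite /word_inv /= rev_cons -cats1 elt_cat -/(word_inv w) IH elt1 elt_cons.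
by rewrite invgM freeprod_letterV.
Qed.

Lemma reduced_cons x w :
  reduced (x :: w) = [&& ~~ letter_trivial x, ~~ starts (side x) w & reduced w].
Proof.
rewrite /reduced /=; case: w => [|y w] /=; first by rewrite andbT.
by rewrite eq_sym -!andbA; do !bool_congr.
Qed.

Lemma starts_flip o w : starts o w -> ~~ starts (~~ o) w.
Proof. by case: w => //= x _ /eqP->; case: o. Qed.

Lemma starts_cat o s t : starts o s -> starts o (s ++ t).
Proof. by case: s. Qed.

Lemma word_inv_cat s t : word_inv (s ++ t) = word_inv t ++ word_inv s.
Proof. by rewrite /word_inv map_cat rev_cat. Qed.

Lemma word_inv_rcons s x : word_inv (rcons s x) = linv x :: word_inv s.
Proof. by rewrite /word_inv map_rcons rev_rcons. Qed.

Lemma size_word_inv s : size (word_inv s) = size s.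
Proof. by rewrite size_rev size_map. Qed.

(** [starts o (word_inv s)] says that [s] ends on side [o]. *)
Lemma reduced_cat o s t : reduced s -> reduced t ->
  starts o (word_inv s) -> ~~ starts o t -> reduced (s ++ t).
Proof.
move=> rs rt; case/lastP: s rs => [|s x rs]; first by [].
rewrite word_inv_rcons /= letter_side_inv => /eqP <- nt.
elim: s rs => [|y s IH]; rewrite /= !reduced_cons.
  by move=> /andP[-> _]; rewrite nt rt.
move=> /and3P[-> ns rs]; rewrite IH // andbT /=.
by move: ns; case: (s).
Qed.

Lemma reduced_catl s t : reduced (s ++ t) -> reduced s.
Proof.
elim: s => //= x s IH; rewrite !reduced_cons => /and3P[-> ns /IH ->].
by rewrite andbT; move: ns; case: (s).
Qed.

Lemma reduced_catr s t : reduced (s ++ t) -> reduced t.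
Proof. by elim: s => //= x s IH; rewrite reduced_cons => /and3P[_ _ /IH]. Qed.

Definition start o g : bool := starts o (val g).

Lemma start_flip o g : start o g -> ~~ start (~~ o) g.
Proof. exact: starts_flip. Qed.

Lemma startP g : g <> 1 -> exists o, start o g.
Proof.
move=> g1; have : val g <> [::] by move=> e; apply: g1; apply: val_inj.
by rewrite /start; case: (val g) => // x s _; exists (side x) => /=.
Qed.

Lemma valV g : val g^-1 = word_inv (val g). Proof. by []. Qed.

Lemma val_mul o g h : start o g^-1 -> ~~ start o h -> val (g * h) = val g ++ val h.
Proof.
move=> gV nh; rewrite -(@val_elt (val g ++ val h)); first by rewrite elt_cat !elt_val.
by apply: (@reduced_cat o); rewrite ?(valP g) ?(valP h).
Qed.

Lemma start_mul o o' g h :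
  start o g^-1 -> start o' g -> ~~ start o h -> start o' (g * h).
Proof.
by move=> gV sg nh; rewrite /start (val_mul gV nh); apply: starts_cat.
Qed.

Lemma start_neq1 o g : start o g -> g <> 1.
Proof. by move=> sg e; move: sg; rewrite e. Qed.

Lemma start_inv_ex g : g <> 1 -> exists o, start o g^-1.
Proof.
by move=> g1; apply: startP => e; apply: g1; rewrite -[g]invgK e invg1.
Qed.

Lemma val_letter x : ~~ letter_trivial x -> val (lt x) = [:: x].
Proof. by move=> nx; rewrite /= /letter_act (negbTE nx). Qed.

Lemma start_letter x : ~~ letter_trivial x -> start (side x) (lt x).
Proof. by move=> nx; rewrite /start val_letter //= eqxx. Qed.

Lemma start_letterV x : ~~ letter_trivial x -> start (side x) (lt x)^-1.
Proof.
move=> nx; rewrite -freeprod_letterV -letter_side_inv; apply: start_letter.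
by rewrite letter_trivial_inv.
Qed.

Lemma letter_inj x y : ~~ letter_trivial x -> lt x = lt y -> x = y.
Proof.
move=> nx e; have ny : ~~ letter_trivial y.
  apply/negP => /freeprod_letter_trivial ly; have := start_letter nx.
  by rewrite e ly.
by have := congr1 val e; rewrite !val_letter // => -[].
Qed.

(** * Elliptic elements *)

(** [ell w c] fixes one vertex of the Bass-Serre tree, and the word [rcons w c],
    called its half, encodes the path to this vertex together with the rotation
    around it. *)
Definition ell w c : G := elt w * lt c * (elt w)^-1.

Definition half o w c : bool := reduced (rcons w c) && (side (head c w) == o).

Lemma halfE o w c :
  half o w c = [&& reduced w, ~~ letter_trivial c,
                   ~~ starts (side c) (word_inv w) & side (head c w) == o].
Proof.
rewrite /half -cats1; case/lastP: w => [|w x].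
  by rewrite /= reduced_cons /= andbT.
rewrite word_inv_rcons /= letter_side_inv.
apply/andP/and4P => [[r ->]|[rw nc xc ->]]; split=> //.
- exact: reduced_catl r.
- by have := reduced_catr r; rewrite reduced_cons => /and3P[].
- move: r; rewrite cat_rcons => /reduced_catr; rewrite reduced_cons.
  by rewrite /= eq_sym => /and3P[].
apply: (@reduced_cat (side x)) => //; first by rewrite reduced_cons nc.
  by rewrite word_inv_rcons /= letter_side_inv.
by rewrite /= eq_sym.
Qed.

Lemma ell_cat s w c : ell (s ++ w) c = elt s * ell w c * (elt s)^-1.
Proof. by rewrite /ell elt_cat invgM !mulgA. Qed.

Lemma ell0 c : ell [::] c = lt c.
Proof. by rewrite /ell elt_nil invg1 mulg1 mul1g. Qed.

Lemma ellV w c : (ell w c)^-1 = ell w (linv c).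
Proof. by rewrite /ell !invgM invgK freeprod_letterV !mulgA. Qed.

Lemma half_inv o w c : half o w c -> half o w (linv c).
Proof.
rewrite !halfE letter_trivial_inv letter_side_inv => /and4P[-> -> -> /=].
by case: w => //=; rewrite letter_side_inv.
Qed.

Lemma elt_half o w c : half o w c -> reduced (rcons w c ++ word_inv w).
Proof.
rewrite halfE => /and4P[rw nc sw _].
have rwc : reduced (rcons w c).
  have : half (side (head c w)) w c by rewrite halfE rw nc sw eqxx.
  by move=> /andP[].
apply: (@reduced_cat (side c)) => //; first exact: word_inv_reduced.
by rewrite word_inv_rcons /= letter_side_inv.
Qed.

Lemma val_ell o w c : half o w c -> val (ell w c) = rcons w c ++ word_inv w.
Proof.
move=> hw; rewrite -(val_elt (elt_half hw)) elt_cat eltV -cats1 elt_cat elt1 //.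
Qed.

Lemma start_ell o w c : half o w c -> start o (ell w c).
Proof.
move=> hw; rewrite /start (val_ell hw).
by have /andP[_] := hw; case: w {hw}.
Qed.

Lemma start_ellV o w c : half o w c -> start o (ell w c)^-1.
Proof. by move=> hw; rewrite ellV; apply: start_ell; apply: half_inv. Qed.

Lemma ell_prefix o w c h : half o w c -> ~~ start o h ->
  prefix (rcons w c) (val (ell w c * h)).
Proof.
move=> hw nh; rewrite (val_mul (start_ellV hw) nh) (val_ell hw) -catA.
exact: prefix_prefix.
Qed.

Lemma half_drop o s y w c : half o (s ++ y :: w) c -> half (~~ side y) w c.
Proof.
rewrite /half rcons_cat /= => /andP[/reduced_catr + _].
rewrite reduced_cons => /and3P[_ + ->] /=.
by case: w => [|z w] /=; case: (side _); case: (side _).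
Qed.

(** Moving the base point to the vertex of [ell w c] keeps elements that lie on
    the other side of the old base point in front of the new one. *)
Lemma half_shift o w c w' c' : half o w c -> half (~~ o) w' c' ->
  half (~~ side c) (word_inv w ++ w') c'.
Proof.
rewrite halfE => /and4P[rw nc sw /eqP hw] /andP[r' /eqP h'].
rewrite /half rcons_cat; apply/andP; split.
  case: w rw sw hw => [//|x w] rw sw hw.
  apply: (@reduced_cat o) => //; first exact: word_inv_reduced.
    by rewrite word_invK /= hw eqxx.
  by case: w' r' h' => [|y w'] _ /= ->; case: (o).
case/lastP: w rw sw hw => [|w x] rw sw hw; last first.
  by move: sw; rewrite word_inv_rcons /= letter_side_inv; case: (side x); case: (side c).
by move: hw h' => /= -> ->.
Qed.

Lemma half_letter c : ~~ letter_trivial c -> half (side c) [::] c.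
Proof. by move=> nc; rewrite /half /= reduced_cons nc eqxx. Qed.

Lemma half_nontrivial o w c : half o w c -> ~~ letter_trivial c.
Proof. by rewrite halfE => /and4P[]. Qed.

Lemma ell_involution w c : linv c = c -> ell w c * ell w c = 1.
Proof. by move=> cc; rewrite -{1}cc -ellV mulVg. Qed.

(** In the two middle cases the longer path runs through the vertex of the shorter
    half and leaves it by the letter of this half, which folds it back. *)
Lemma half_cases s c s' c' :
  [\/ s = s' /\ c = c', exists r, s' = s ++ c :: r, exists r, s = s' ++ c' :: r
    | forall w, prefix (rcons s c) w -> prefix (rcons s' c') w -> False].
Proof.
have [p|p] := boolP (prefix (rcons s c) (rcons s' c')).
  have [t e] := prefixP p; case/lastP: t e => [|r z].
    by rewrite cats0 => /rcons_inj[-> ->]; constructor 1.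
  by rewrite -rcons_cat => /rcons_inj[-> _]; constructor 2; exists r; rewrite cat_rcons.
have [p'|p'] := boolP (prefix (rcons s' c') (rcons s c)).
  have [t e] := prefixP p'; case/lastP: t e => [|r z].
    by rewrite cats0 => /rcons_inj[-> ->]; constructor 1.
  by rewrite -rcons_cat => /rcons_inj[-> _]; constructor 3; exists r; rewrite cat_rcons.
constructor 4 => w; rewrite !prefixE => /eqP e /eqP e'.
have [le|/ltnW le] := leqP (size (rcons s c)) (size (rcons s' c')).
  by move: p; rewrite prefixE -e' take_takel // e eqxx.
by move: p'; rewrite prefixE -e take_takel // e' eqxx.
Qed.

Lemma reduced_parity x s :
  reduced (x :: s) -> odd (size s) = (side (last x s) != side x).
Proof.
elim: s x => [|y s IH] x; first by rewrite /= eqxx.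
rewrite reduced_cons => /and3P[_ nxy /IH /= ->].
by move: nxy => /=; case: (side y); case: (side x); case: (side _).
Qed.

(** The even words are those whose two ends are on different sides, that is, the
    cyclically reduced ones apart from the letters. *)
Definition hyperbolic g : Prop :=
  exists h, let s := val (h * g * h^-1) in (0 < size s)%N && ~~ odd (size s).

(** Peeling the first and the last letter never makes them merge, since this would
    leave an even word. *)
Lemma elliptic_half g : g <> 1 -> ~ hyperbolic g ->
  exists o w c, half o w c /\ g = ell w c.
Proof.
move: {2}_.+1 (ltnSn (size (val g))) => n; elim: n g => // n IH g gn g1 nh.
have Eg := elt_val g; have rg := valP g.
case E: (val g) Eg rg gn => [|x s] Eg rg gn; first by case: g1; rewrite -Eg elt_nil.
have nx : ~~ letter_trivial x by move: rg; rewrite reduced_cons => /and3P[].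
case/lastP: s E Eg rg gn => [|s y] E Eg rg gn.
  exists (side x), [::], x; rewrite half_letter //; split=> //.
  by rewrite ell0 -Eg elt1.
have rs : reduced s.
  by move: rg; rewrite reduced_cons -cats1 => /and3P[_ _ /reduced_catl].
have ny : ~~ letter_trivial y.
  move: rg; rewrite -cats1 -cat_cons => /reduced_catr.
  by rewrite reduced_cons => /and3P[].
have gE : g = lt x * elt s * lt y by rewrite -Eg elt_cons -cats1 elt_cat elt1 mulgA.
have xy : side y = side x.
  apply/eqP/negPn/negP => xy; apply: nh; exists 1.
  by rewrite mul1g invg1 mulg1 E /= (reduced_parity rg) last_rcons xy.
have os : odd (size s).
  by have := reduced_parity rg; rewrite last_rcons xy eqxx size_rcons /= => /negbFE.
have conj : (lt x)^-1 * g * ((lt x)^-1)^-1 = elt s * (lt y * lt x).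
  by rewrite invgK gE !mulgA mulVg mul1g.
have [z [sz ez tz _ _]] := letter_merge xy.
have [t|nz] := boolP (letter_trivial z); last first.
  case: nh; exists (lt x)^-1; rewrite conj ez -elt1 -elt_cat cats1 val_elt.
    by rewrite /= size_rcons /= os.
  move: rg; rewrite reduced_cons -!cats1 => /and3P[_ _ rsy].
  apply: (@reduced_cat (~~ side z)) => //; first by rewrite reduced_cons nz.
    case/lastP: (s) rsy os {IH E Eg gE conj rs gn} => // s' u.
    rewrite cat_rcons => /reduced_catr; rewrite reduced_cons => /and3P[_ + _] _.
    by rewrite word_inv_rcons /= letter_side_inv sz; case: (side _); case: (side _).
  by rewrite /=; case: (side z).
have gs : elt s = (lt x)^-1 * g * ((lt x)^-1)^-1.
  by rewrite conj ez freeprod_letter_trivial // mulg1.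
have [|||o [w [c [hw ew]]]] := IH (elt s).
- by move: gn; rewrite /= size_rcons val_elt // !ltnS => /ltnW.
- by move/(congr1 val); rewrite val_elt //= => s0; rewrite s0 in os.
- case=> h; rewrite gs => hh; apply: nh; exists (h * (lt x)^-1).
  by rewrite invgM !mulgA in hh *.
have sE := val_ell hw; rewrite -ew val_elt // in sE.
exists (side x), (x :: w), c; split; last first.
  rewrite -cat1s ell_cat -ew gs elt1 invgK !mulgA mulgV mul1g.
  by rewrite -mulgA mulgV mulg1.
rewrite /half /= eqxx andbT reduced_cons nx /=; have /andP[-> _] := hw.
rewrite andbT; move: rg; rewrite reduced_cons sE => /and3P[_ + _].
by case: (w).
Qed.

End Words.

(** * Foldings in abstract groups *)

Section AbstractFoldings.
Variable G : groupType.
Implicit Types (a b c h k w x y u : G).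

Lemma involution_cancel x : x * x = 1 -> forall h, h * x * x = h.
Proof. by move=> xx h; rewrite -mulgA xx mulg1. Qed.

Lemma involution_inv x : x * x = 1 -> x^-1 = x.
Proof. exact: mulg1_eq. Qed.

Lemma conj_mul h x y : h * x * h^-1 * (h * y * h^-1) = h * (x * y) * h^-1.
Proof. by rewrite !mulgA mulgVK. Qed.

Lemma conj_inv h x : (h * x * h^-1)^-1 = h * x^-1 * h^-1.
Proof. by rewrite !invgM invgK mulgA. Qed.

Lemma semifree_eq a b c a' b' c' : semifree a b c ->
  a' = a -> b' = b -> c' = c -> semifree a' b' c'.
Proof. by move=> F -> -> ->. Qed.

Lemma free_tri_conj a b c a' b' c' h : free_family (tri a b c) ->
  a' = h * a * h^-1 -> b' = h * b * h^-1 -> c' = h * c * h^-1 ->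
  free_family (tri a' b' c').
Proof. by move=> F -> -> ->; apply: free_conj F => -[[]|]. Qed.

Lemma free_tri_inv a b c a' b' c' : free_family (tri a b c) ->
  a' = a^-1 -> b' = b^-1 -> c' = c^-1 -> free_family (tri a' b' c').
Proof. by move=> F -> -> ->; apply: free_inv F => -[[]|]. Qed.

Lemma free_tri_swap a b c :
  free_family (tri a b c) -> free_family (tri b a c).
Proof.
apply: (free_reindex (p := omap negb)); first by case=> [[]|].
by case=> [[]|] [[]|].
Qed.


(** Put [p = k c] and [q = w c].  Up to inversion and conjugation by [p], the
    conclusion is about [p], [q p] and the same third element. *)
Lemma free_fold_first c k w : c * c = 1 -> k * k = 1 -> w * w = 1 ->
  free_family (tri (w * c) (k * c) (w * k * c)) ->
  free_family (tri (c * k) (c * w * c * k) (w * c * k)).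
Proof.
move=> cc kk ww F.
have Vs := (involution_inv cc, involution_inv kk, involution_inv ww).
have Cs := (involution_cancel cc, involution_cancel kk, involution_cancel ww,
            cc, kk, ww, @mul1g G, @mulg1 G).
have F2 : free_family (tri (k * c) (w * c * (k * c)) (w * k * c)).
  apply: (free_mulr (i := Some true) (j := Some false)) (free_tri_swap F) => //.
  by case=> [[]|].
apply: (free_tri_inv (free_tri_conj (h := k * c) F2 erefl erefl erefl));
  by rewrite !invgM !Vs !mulgA !Cs.
Qed.

Lemma free_fold_second c k x : c * c = 1 -> k * k = 1 -> x * x = 1 ->
  free_family (tri (k * c) (x * c) (k * x * c)) ->
  free_family (tri (c * x * c * k) (c * k) (c * x * k)).
Proof.
move=> cc kk xx F.
have Vs := (involution_inv cc, involution_inv kk, involution_inv xx).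
have F2 : free_family (tri (k * c) (k * c * (x * c)) (k * x * c)).
  apply: (free_mull (i := Some true) (j := Some false)) F => //.
  by case=> [[]|].
by apply: (free_tri_inv (free_tri_swap F2)); rewrite !invgM !Vs ?mulgA.
Qed.

Lemma commute_fold_first c k w : c * c = 1 -> k * k = 1 -> w * w = 1 ->
  w * c * (k * c) = k * c * (w * c) ->
  c * k * (c * w * c * k) = c * w * c * k * (c * k).
Proof.
move=> cc kk ww /(congr1 (fun x : G => x^-1)).
rewrite !invgM !(involution_inv cc, involution_inv kk, involution_inv ww) !mulgA.
by move=> ->.
Qed.

Lemma commute_fold_second c k x : c * c = 1 -> k * k = 1 -> x * x = 1 ->
  k * c * (x * c) = x * c * (k * c) ->
  c * x * c * k * (c * k) = c * k * (c * x * c * k).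
Proof. by move=> cc kk xx e; rewrite (commute_fold_first cc kk xx). Qed.

Lemma semifree_fold_base u d : free_family (duo (u * d) (u^-1 * d)) ->
  semifree (u * d) (u^-1 * d) (u * d * u^-1 * d).
Proof.
move=> F; right; split=> //; exists [:: true; false]; split=> //.
by rewrite !eval_cons eval_nil mulg1 !mulgA.
Qed.

(** With [a], [b], [c] for the three elements of the hypothesis, the folded
    triple is [a], [b], [a c b]. *)
Lemma semifree_fold_mid u d w : semifree (u * d) (u^-1 * d) (w * d) ->
  semifree (u * d) (u^-1 * d) (u * (d * w * d) * u^-1 * d).
Proof. by move/semifree_mid; rewrite !mulgA. Qed.

(** The folded triple is [a c], [b c], [a b c]. *)
Lemma semifree_fold_post u d y : semifree (u * d) (u^-1 * d) (y * d) ->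
  semifree (u * (d * y * d)) (u^-1 * (d * y * d)) (u * d * u^-1 * (d * y * d)).
Proof. by move/semifree_post; rewrite !mulgA. Qed.

(** The inverses of the folded triple are [c b], [c a], [c]. *)
Lemma semifree_fold_pre u d y : d * d = 1 -> y * y = 1 ->
  semifree (u * d) (u^-1 * d) (y * d) ->
  semifree (d * u * d * y) (d * u^-1 * d * y) (d * y).
Proof.
move=> dd yy /semifree_pre/semifree_inv.
by rewrite !invgM invgK (involution_inv dd) (involution_inv yy) !mulgA.
Qed.

(** If [y x] and [z x] commute, [z] inverts the translation [x y]. *)
Lemma commute_reflected x y (z : G) : y * x * (z * x) = z * x * (y * x) ->
  y * x * z = z * (x * y).
Proof. by rewrite !mulgA => /mulIg. Qed.

Lemma commute_reflected_inv x y (z : G) : z * z = 1 ->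
  x * y * (z * y) = z * y * (x * y) -> y * x * z = z * (x * y).
Proof.
move=> zz /commute_reflected e.
have -> : z * (x * y) = z * (x * y * z) * z by rewrite !mulgA (involution_cancel zz).
by rewrite e !mulgA zz mul1g.
Qed.

End AbstractFoldings.

(** * Foldings of elliptic elements *)

Section Foldings.
Variables A B : groupType.
Local Arguments reduced : simpl never.
Local Notation G := (freeprod A B).
Local Notation T := (A + B)%type.
Local Notation lt := (@freeprod_letter A B).
Local Notation side := (@letter_side A B).
Local Notation linv := (@letter_inv A B).
Implicit Types (c : T) (s w x y u k : seq T) (g h : G) (o : bool).

Definition diverging w c w' c' : Prop :=
  forall s, prefix (rcons w c) s -> prefix (rcons w' c') s -> False.

Lemma diverging_sym w c w' c' : diverging w c w' c' -> diverging w' c' w c.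
Proof. by move=> d s p p'; apply: (d s). Qed.

Lemma diverging_inv w c : linv c <> c -> diverging w c w (linv c).
Proof.
move=> nc s; rewrite !prefixE !size_rcons => /eqP -> /eqP /rcons_inj[e].
by apply: nc.
Qed.

Lemma diverging_not_extend w c r c' : ~ diverging (w ++ c :: r) c' w c.
Proof.
move=> d; apply: (d (rcons (w ++ c :: r) c')); first exact: prefix_refl.
by rewrite rcons_cat /= -cat_rcons prefix_prefix.
Qed.

Lemma ell_unshift s w c : ell w c = elt s * ell (word_inv s ++ w) c * (elt s)^-1.
Proof. by rewrite ell_cat eltV invgK !mulgA mulgV mul1g mulgK. Qed.

Lemma ell_cons c w c' : ell (c :: w) c' = lt c * ell w c' * (lt c)^-1.
Proof. by rewrite -cat1s ell_cat elt1. Qed.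

Lemma ell_consM c w c' h :
  ell (c :: w) c' * h = lt c * (ell w c' * ((lt c)^-1 * h)).
Proof. by rewrite ell_cons !mulgA. Qed.

(** Elements elliptic on side [o] with pairwise diverging halves play ping-pong
    against one fixed element that sends side [o] to the other side. *)
Lemma free_diverging (L : eqType) o (w : L -> seq T) (c : L -> T) (k : G) (l0 : L) :
  (forall l : L, exists l', l' != l) ->
  (forall l, half o (w l) (c l)) ->
  (forall l l', l != l' -> diverging (w l) (c l) (w l') (c l')) ->
  start (~~ o) k -> start (~~ o) k^-1 ->
  free_family (fun l => ell (w l) (c l) * k).
Proof.
move=> other hw dv sk skV; apply: (@ping_pong _ _ _ (start o)) => //.
- by exists (ell (w l0) (c l0)); apply: start_ell.
- move=> l h /start_flip sh; rewrite -mulgA.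
  apply: (start_mul (start_ellV (hw l)) (start_ell (hw l))).
  by have := start_flip (start_mul skV sk sh); rewrite negbK.
move=> l l' h h' sh sh' e; apply/eqP/negPn/negP => /dv d.
have nk g : start o g -> ~~ start o (k * g).
  by move/start_flip=> sg; have := start_flip (start_mul skV sk sg); rewrite negbK.
apply: (d (val (ell (w l) (c l) * k * h))).
  by rewrite -mulgA; apply: ell_prefix (hw l) (nk _ sh).
by rewrite e -mulgA; apply: ell_prefix (hw l') (nk _ sh').
Qed.

(** After stripping common first letters, either the halves start differently and
    the image of [h] starts like [s]; or [s] is exhausted and [c] changes the
    letter that follows.  In the second case [c] is not the inverse of this letter,
    because it is its own inverse and the halves diverge. *)
Lemma diverging_moved o s c s' c' h :
  half o s c -> half o s' c' -> linv c = c -> diverging s c s' c' ->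
  prefix (rcons s' c') (val h) ->
  start o (ell s c * h) /\ ~~ prefix (rcons s' c') (val (ell s c * h)).
Proof.
elim: s o s' h => [|e s IH] o s' h hs hs' cc dv p'.
  have nc := half_nontrivial hs.
  have sc : side c = o by have /andP[_ /eqP] := hs.
  have [f [p'E sf]] : exists f, ohead (rcons s' c') = Some f /\ side f = o.
    by have /andP[_ /eqP] := hs'; case: (s') => [|f ?] /= <-; eexists.
  have [r E] : exists r, val h = f :: r.
    by have [r ->] := prefixP p'; case: (s') p'E => [|? ?] [->]; eexists.
  have fc : f <> c.
    move=> fc; apply: (dv (val h)) => //.
    by rewrite E fc prefix_cons eqxx prefix0s.
  have rh := valP h; rewrite E reduced_cons in rh; have /and3P[nf nr rr] := rh.
  have cf : side c = side f by rewrite sc sf.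
  have [z [sz ez tz zf _]] := letter_merge cf.
  have nz : ~~ letter_trivial z.
    by apply/negP => /tz cE; apply: fc; rewrite -cc cE letter_invK.
  have ev : val (ell [::] c * h) = z :: r.
    rewrite ell0 -(elt_val h) E elt_cons mulgA ez -elt_cons val_elt //.
    by rewrite reduced_cons nz sz cf nr rr.
  rewrite /start ev; split; first by rewrite /= sz sc eqxx.
  have [q ->] : exists q, rcons s' c' = f :: q.
    by case: (s') p'E => [|? ?] /= [->]; eexists.
  apply/negP; rewrite prefix_cons => /andP[/eqP fz _].
  by move: nc; rewrite zf.
have [f [p'E sf]] : exists f, ohead (rcons s' c') = Some f /\ side f = o.
  by have /andP[_ /eqP] := hs'; case: (s') => [|f ?] /= <-; eexists.
have [r E] : exists r, val h = f :: r.
  by have [r ->] := prefixP p'; case: (s') p'E => [|? ?] /= [->]; eexists.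
have hs1 : half (~~ side e) s c by apply: (@half_drop _ _ o [::]).
have [ne se] : ~~ letter_trivial e /\ side e = o.
  by have /andP[] := hs; rewrite /= reduced_cons => /and3P[-> _ _] /eqP.
have rh := valP h; rewrite E reduced_cons in rh; have /and3P[nf nr rr] := rh.
rewrite ell_consM.
have [fe|fe] := eqVneq f e.
  rewrite -(elt_val h) E elt_cons fe mulKg.
  case: s' p'E hs' dv p' => [|e' s'] p'E hs' dv p'.
    have e'f : c' = f by case: p'E.
    by case: (dv [:: e & rcons s c]) => [|];
      rewrite ?prefix_refl // e'f fe prefix_cons eqxx prefix0s.
  have e'f : e' = f by case: p'E.
  rewrite e'f fe in hs' dv p' *.
  have [|||sl np] := IH (~~ side e) s' (elt r) hs1 _ cc.
  - by apply: (@half_drop _ _ o [::]).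
  - move=> t p1 p2; apply: (dv (e :: t)); by rewrite ?rcons_cons prefix_cons eqxx.
  - by rewrite val_elt //; move: p'; rewrite E fe ?rcons_cons prefix_cons eqxx.
  have ev : val (lt e * (ell s c * elt r)) = e :: val (ell s c * elt r).
    rewrite (val_mul (start_letterV ne)) ?val_letter //.
    by have := start_flip sl; rewrite negbK.
  rewrite /start ev; split; first by rewrite /= se eqxx.
  by rewrite ?rcons_cons prefix_cons eqxx.
have ef : side (linv e) = side f by rewrite letter_side_inv se sf.
have [z [sz ez tz _ _]] := letter_merge ef.
have nz : ~~ letter_trivial z.
  by apply/negP => /tz /(inv_inj (@letter_invK A B)) fE; rewrite fE eqxx in fe.
have sin : start o ((lt e)^-1 * h).
  rewrite -(elt_val h) E elt_cons mulgA -freeprod_letterV ez -elt_cons.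
  rewrite /start val_elt /= ?sz ?letter_side_inv ?se ?eqxx //.
  by rewrite reduced_cons nz sz ef nr rr.
have sl : start (~~ side e) (ell s c * ((lt e)^-1 * h)).
  apply: (start_mul (start_ellV hs1) (start_ell hs1)).
  by rewrite se; apply: start_flip.
have ev : val (lt e * (ell s c * ((lt e)^-1 * h))) =
          e :: val (ell s c * ((lt e)^-1 * h)).
  rewrite (val_mul (start_letterV ne)) ?val_letter //.
  by have := start_flip sl; rewrite negbK.
rewrite /start ev; split; first by rewrite /= se eqxx.
have [q ->] : exists q, rcons s' c' = f :: q.
  by case: (s') p'E => [|? ?] /= [->]; eexists.
by rewrite prefix_cons (negbTE fe).
Qed.

(** An edge separates [K] from [X] and [W].  If the halves of [X] and [W] diverge,
    the half-tree of [K] is moved to disjoint places by [X], [W] and [X W].  If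
    the half of [W] continues that of [X], then [W] is the conjugate by [X] of
    an involution [W'] which, seen from the vertex of [X], lies on the same side
    as [K]; the shorter configuration of [X] against [W'] and [K] gives the
    result by a Nielsen move.  The process cannot end with [X = W], because the
    products [X K] and [W K] do not commute. *)
Lemma involutive_triple n o k ck x cx w cw :
  (size k + size x + size w < n)%N ->
  half (~~ o) k ck -> half o x cx -> half o w cw ->
  linv ck = ck -> linv cx = cx -> linv cw = cw ->
  let K := ell k ck in let X := ell x cx in let W := ell w cw in
  X * K * (W * K) <> W * K * (X * K) ->
  free_family (tri (X * K) (W * K) (X * W * K)).
Proof.
elim: n o k ck x cx w cw => // n IH o k ck x cx w cw sn hk hx hw kk xx ww K X W.
have KK : K * K = 1 by apply: ell_involution.
have XX : X * X = 1 by apply: ell_involution.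
have WW : W * W = 1 by apply: ell_involution.
have [[ex ec]|[r E]|[r E]|dv] := half_cases x cx w cw.
- by rewrite /X ex ec.
- move=> nc; pose C := lt cx; pose W' := ell r cw.
  pose K' := ell (word_inv x ++ k) ck.
  have CC : C * C = 1 by rewrite /C -ell0; apply: ell_involution.
  have K'K' : K' * K' = 1 by apply: ell_involution.
  have W'W' : W' * W' = 1 by apply: ell_involution.
  have XE : X = elt x * C * (elt x)^-1 by [].
  have KE : K = elt x * K' * (elt x)^-1 by apply: ell_unshift.
  have WE : W = elt x * (C * W' * C) * (elt x)^-1.
    by rewrite /W E ell_cat ell_cons (involution_inv CC).
  have F : free_family (tri (W' * C) (K' * C) (W' * K' * C)).
    rewrite /C -ell0; apply: (IH (~~ side cx)) => //.
    - by move: sn; rewrite E !size_cat /= size_word_inv; lia.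
    - by rewrite negbK; apply: half_letter; apply: half_nontrivial hx.
    - by apply: (@half_drop _ _ o x); rewrite -E.
    - exact: half_shift hx hk.
    rewrite ell0 => /(commute_fold_first CC K'K' W'W') e; apply: nc.
    by rewrite XE KE WE !conj_mul e.
  apply: (free_tri_conj (h := elt x) (free_fold_first CC K'K' W'W' F));
    rewrite ?XE ?KE ?WE !conj_mul //.
  by rewrite !mulgA (involution_cancel CC).
- move=> nc; pose C := lt cw; pose X' := ell r cx.
  pose K' := ell (word_inv w ++ k) ck.
  have CC : C * C = 1 by rewrite /C -ell0; apply: ell_involution.
  have K'K' : K' * K' = 1 by apply: ell_involution.
  have X'X' : X' * X' = 1 by apply: ell_involution.
  have WE : W = elt w * C * (elt w)^-1 by [].
  have KE : K = elt w * K' * (elt w)^-1 by apply: ell_unshift.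
  have XE : X = elt w * (C * X' * C) * (elt w)^-1.
    by rewrite /X E ell_cat ell_cons (involution_inv CC).
  have F : free_family (tri (K' * C) (X' * C) (K' * X' * C)).
    rewrite /C -ell0; apply: (IH (~~ side cw)) => //.
    - by move: sn; rewrite E !size_cat /= size_word_inv; lia.
    - by rewrite negbK; apply: half_letter; apply: half_nontrivial hw.
    - exact: half_shift hw hk.
    - by apply: (@half_drop _ _ o w); rewrite -E.
    rewrite ell0 => /(commute_fold_second CC K'K' X'X') e; apply: nc.
    by rewrite XE KE WE !conj_mul e.
  apply: (free_tri_conj (h := elt w) (free_fold_second CC K'K' X'X' F));
    rewrite ?XE ?KE ?WE !conj_mul //.
  by rewrite !mulgA (involution_cancel CC).
move=> _; have nk h : start o h -> ~~ start o (K * h).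
  move/start_flip=> sh.
  by have := start_flip (start_mul (start_ellV hk) (start_ell hk) sh); rewrite negbK.
have sX h : ~~ start o h -> start o (X * h).
  by apply: start_mul (start_ellV hx) (start_ell hx).
have sW h : ~~ start o h -> start o (W * h).
  by apply: start_mul (start_ellV hw) (start_ell hw).
have mv h : ~~ start o h -> start o (X * (W * h)) /\
    ~~ prefix (rcons w cw) (val (X * (W * h))).
  by move=> nh; apply: (diverging_moved hx hw) => //; apply: ell_prefix nh.
have pX h : ~~ start o h -> prefix (rcons x cx) (val (X * h)) by apply: ell_prefix.
have pW h : ~~ start o h -> prefix (rcons w cw) (val (W * h)) by apply: ell_prefix.
have s1 : start o X by apply: start_ell hx.
clearbody K X W; apply: (@ping_pong _ _ _ (start o)) => //.
- by exists X.
- by case=> [b|]; [exists None|exists (Some true)].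
- case=> [[]|] h sh /=; rewrite -!mulgA.
  + by apply: sX; apply: nk.
  + by apply: sW; apply: nk.
  + by case: (mv _ (nk _ sh)).
have XW g g' : start o g -> start o g' -> X * (K * g) <> W * (K * g').
  move=> /nk ng /nk ng' e; apply: (dv (val (X * (K * g)))).
    exact: pX.
  by rewrite e; apply: pW.
have XO g g' : start o g -> start o g' -> X * (K * g) <> X * (W * (K * g')).
  by move=> /nk ng /nk /sW sg' /mulgI e; rewrite e sg' in ng.
have WO g g' : start o g -> start o g' -> W * (K * g) <> X * (W * (K * g')).
  move=> /nk ng /nk /mv[_ /negP np] e; apply: np; rewrite -e.
  exact: pW.
case=> [[]|] [[]|] h h' sh sh' //=; rewrite -!mulgA => e.
- by case: (XW _ _ sh sh' e).
- by case: (XO _ _ sh sh' e).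
- by case: (XW _ _ sh' sh (esym e)).
- by case: (WO _ _ sh sh' e).
- by case: (XO _ _ sh' sh (esym e)).
- by case: (WO _ _ sh' sh (esym e)).
Qed.

(** [C] and its inverse send the half-tree containing the vertices of [Y1] and
    [W1] to disjoint half-trees, and the diverging halves keep the two images in
    the first of them apart. *)
Lemma free_at_vertex c y1 cy r cw :
  ~~ letter_trivial c -> linv c <> c ->
  half (~~ side c) y1 cy -> half (~~ side c) r cw -> diverging y1 cy r cw ->
  let C := lt c in let Y1 := ell y1 cy in let W1 := ell r cw in
  free_family (tri (C * Y1) (C^-1 * Y1) (C * W1)).
Proof.
move=> nc cc hy1 hw1 dv C Y1 W1.
have pY h : start (side c) h ->
    prefix (rcons y1 cy) (val (Y1 * h)) /\ start (~~ side c) (Y1 * h).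
  move=> /start_flip nh; split; first exact: ell_prefix nh.
  exact: start_mul (start_ellV hy1) (start_ell hy1) nh.
have pW h : start (side c) h ->
    prefix (rcons r cw) (val (W1 * h)) /\ start (~~ side c) (W1 * h).
  move=> /start_flip nh; split; first exact: ell_prefix nh.
  exact: start_mul (start_ellV hw1) (start_ell hw1) nh.
have vC h : start (~~ side c) h -> val (C * h) = c :: val h.
  move=> /start_flip; rewrite negbK => nh.
  by rewrite (val_mul (start_letterV nc)) ?val_letter.
have vCV h : start (~~ side c) h -> val (C^-1 * h) = linv c :: val h.
  move=> /start_flip; rewrite negbK => nh; rewrite /C -freeprod_letterV.
  rewrite (val_mul (o := side c)) ?val_letter ?letter_trivial_inv //.
  by rewrite freeprod_letterV invgK; apply: start_letter.
have sC : start (side c) C by apply: start_letter.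
clearbody C Y1 W1; apply: (@ping_pong _ _ _ (start (side c))).
- by exists C.
- by case=> [b|]; [exists None|exists (Some true)].
- case=> [[]|] h /[dup] /pY[_ sY] /pW[_ sW] /=; rewrite -!mulgA /start.
  + by rewrite vC //= eqxx.
  + by rewrite vCV //= letter_side_inv eqxx.
  + by rewrite vC //= eqxx.
case=> [[]|] [[]|] h h' /[dup] /pY[pYh sYh] /pW[pWh sWh]
  /[dup] /pY[pYh' sYh'] /pW[pWh' sWh'] //= /(congr1 val);
  rewrite -!mulgA ?vC ?vCV // => -[] //.
- by move=> /esym.
- move=> eYW; case: (dv (val (Y1 * h))) => //.
  by have -> : val (Y1 * h) = val (W1 * h') := eYW.
- move=> eYW; case: (dv (val (Y1 * h'))) => //.
  by have <- : val (W1 * h) = val (Y1 * h') := eYW.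
- by move=> /esym.
Qed.

(** The same descent with [U] of order at least 3.  When the half of [W] runs
    through the vertex of [U] along the letter of [U], this letter is not an
    involution, and a second folding, of [Y] against the rest of [W], is needed
    to come back to a configuration of the same kind.  This second step may find
    [Y] equal to the rest of [W], which is the redundant case of [semifree]. *)
Lemma mixed_triple n o y cy u cu w cw :
  (size y + size u + size w < n)%N ->
  half (~~ o) y cy -> half o u cu -> half o w cw ->
  linv cy = cy -> linv cw = cw -> linv cu <> cu ->
  let Y := ell y cy in let U := ell u cu in let W := ell w cw in
  semifree (U * Y) (U^-1 * Y) (W * Y).
Proof.
elim: n o y cy u cu w cw => // n IH o y cy u cu w cw sn hy hu hw yy ww uu Y U W.
(* The letter [c] stands for that of [U] or for its inverse. *)
have mid c : half o u c -> linv c <> c -> (exists r, w = u ++ c :: r) ->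
    semifree (ell u c * Y) ((ell u c)^-1 * Y) (W * Y).
  move=> hc cc [r E]; pose C := lt c; pose y1 := word_inv u ++ y.
  pose Y1 := ell y1 cy; pose W1 := ell r cw.
  have YE : Y = elt u * Y1 * (elt u)^-1 by apply: ell_unshift.
  have WE : W = elt u * (C * W1 * C^-1) * (elt u)^-1.
    by rewrite /W E ell_cat ell_cons.
  have hy1 : half (~~ side c) y1 cy by apply: half_shift hc hy.
  have hw1 : half (~~ side c) r cw by apply: (@half_drop _ _ o u); rewrite -E.
  have nc := half_nontrivial hc; have hc0 := half_letter nc.
  have hcV := half_inv hc0.
  suff : semifree (C * Y1) (C^-1 * Y1) (C * W1 * C^-1 * Y1).
    move=> F; apply: (semifree_eq (semifree_conj (elt u) F)).
    - by rewrite YE -(conj_mul (elt u) C Y1).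
    - by rewrite YE -(conj_mul (elt u) C^-1 Y1) ellV /C -freeprod_letterV.
    - by rewrite WE YE conj_mul.
  have sz : (size y1 = size u + size y)%N by rewrite size_cat size_word_inv.
  have szw : (size w = size u + (size r).+1)%N by rewrite E size_cat.
  have [[ey ec]|[r2 E2]|[r2 E2]|dv] := half_cases y1 cy r cw.
  - rewrite /W1 -ey -ec -/Y1; apply: semifree_fold_base.
    have F := @free_diverging bool (side c) (fun=> [::])
      (fun b => if b then c else linv c) Y1 true.
    apply: (free_reindex (p := id)) (F _ _ _ _ _) => //.
    + by case; rewrite ell0 // freeprod_letterV.
    + by move=> b; exists (~~ b); case: b.
    + by case.
    + case=> [] [] // _; first exact: diverging_inv.
      exact/diverging_sym/diverging_inv.
    + exact: start_ell hy1.
    + exact: start_ellV hy1.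
  - pose D := lt cy; pose W2 := ell r2 cw; pose u2 := word_inv y1 ++ [::].
    pose U2 := ell u2 c.
    have DD : D * D = 1 by rewrite /D -ell0; apply: ell_involution.
    have CE : C = elt y1 * U2 * (elt y1)^-1 by rewrite /C -ell0; apply: ell_unshift.
    have Y1E : Y1 = elt y1 * D * (elt y1)^-1 by [].
    have W1E : W1 = elt y1 * (D * W2 * D) * (elt y1)^-1.
      by rewrite /W1 E2 ell_cat ell_cons (involution_inv DD).
    have F : semifree (U2 * D) (U2^-1 * D) (W2 * D).
      rewrite /D -ell0; apply: (IH (~~ side cy)) => //.
      + have su2 : size u2 = size y1 by rewrite size_cat size_word_inv addn0.
        have sr : size r = (size y1 + (size r2).+1)%N by rewrite E2 size_cat.
        by move: sn; rewrite szw /=; lia.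
      + by rewrite negbK; apply: half_letter; apply: half_nontrivial hy.
      + by apply: (half_shift hy1); rewrite negbK.
      + by apply: (@half_drop _ _ (~~ side c) y1); rewrite -E2.
    apply: (semifree_eq (semifree_conj (elt y1) (semifree_fold_mid F))).
    + by rewrite CE Y1E conj_mul.
    + by rewrite CE Y1E conj_inv conj_mul.
    + by rewrite CE W1E Y1E conj_inv !conj_mul.
  - pose D := lt cw; pose Y2 := ell r2 cy; pose u2 := word_inv r ++ [::].
    pose U2 := ell u2 c.
    have DD : D * D = 1 by rewrite /D -ell0; apply: ell_involution.
    have CE : C = elt r * U2 * (elt r)^-1 by rewrite /C -ell0; apply: ell_unshift.
    have Y1E : Y1 = elt r * (D * Y2 * D) * (elt r)^-1.
      by rewrite /Y1 E2 ell_cat ell_cons (involution_inv DD).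
    have F : semifree (U2 * D) (U2^-1 * D) (Y2 * D).
      rewrite /D -ell0; apply: (IH (~~ side cw)) => //.
      + have su2 : size u2 = size r by rewrite size_cat size_word_inv addn0.
        have sy : size y1 = (size r + (size r2).+1)%N by rewrite E2 size_cat.
        by move: sn; rewrite szw /=; lia.
      + by rewrite negbK; apply: half_letter; apply: half_nontrivial hw.
      + by apply: (half_shift hw1); rewrite negbK.
      + by apply: (@half_drop _ _ (~~ side c) r); rewrite -E2.
    have W1E : W1 = elt r * D * (elt r)^-1 by [].
    apply: (semifree_eq (semifree_conj (elt r) (semifree_fold_post F))).
    + by rewrite CE Y1E conj_mul.
    + by rewrite CE Y1E conj_inv conj_mul.
    + by rewrite CE W1E Y1E conj_inv !conj_mul.
  left.
  have F : free_family (tri (C * Y1) (C^-1 * Y1) (C * W1)) by apply: free_at_vertex.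
  apply: (free_mulr (i := Some false) (j := None)) F => //=; first by rewrite !mulgA.
  by case=> [[]|].
have [[_ ec]|E|[r E]|dv] := half_cases u cu w cw.
- by case: uu; rewrite ec.
- exact: mid.
- pose D := lt cw; pose U1 := ell r cu; pose Y1 := ell (word_inv w ++ y) cy.
  have DD : D * D = 1 by rewrite /D -ell0; apply: ell_involution.
  have YY : Y1 * Y1 = 1 by apply: ell_involution.
  have YE : Y = elt w * Y1 * (elt w)^-1 by apply: ell_unshift.
  have WE : W = elt w * D * (elt w)^-1 by [].
  have UE : U = elt w * (D * U1 * D) * (elt w)^-1.
    by rewrite /U E ell_cat ell_cons (involution_inv DD).
  have F : semifree (U1 * D) (U1^-1 * D) (Y1 * D).
    rewrite /D -ell0; apply: (IH (~~ side cw)) => //.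
    - by move: sn; rewrite E !size_cat /= size_word_inv; lia.
    - by rewrite negbK; apply: half_letter; apply: half_nontrivial hw.
    - by apply: (@half_drop _ _ o w); rewrite -E.
    - exact: half_shift hw hy.
  apply: (semifree_eq (semifree_conj (elt w) (semifree_fold_pre DD YY F))).
  - by rewrite UE YE conj_mul.
  - rewrite UE YE conj_inv conj_mul !invgM (involution_inv DD).
    by rewrite !mulgA.
  - by rewrite WE YE conj_mul.
have [[_ ec]|E|[r E]|dv'] := half_cases u (linv cu) w cw.
- by case: uu; rewrite ec -ww -ec letter_invK.
- apply: semifree_swap; rewrite ellV -[U]invgK ellV; apply: mid => //.
    exact: half_inv.
  by rewrite letter_invK => /esym.
- by case: (@diverging_not_extend w cw r cu); rewrite -E.
left; have F := @free_diverging (option bool) o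
  (fun l => if l is None then w else u)
  (fun l => match l with Some true => cu | Some false => linv cu | None => cw end)
  Y None.
apply: (free_reindex (p := id)) (F _ _ _ _ _) => //.
- by case=> [[]|] //=; rewrite -ellV.
- by case=> [b|]; [exists None|exists (Some true)].
- by case=> [[]|] //; apply: half_inv.
- case=> [[]|] [[]|] //= _; first [exact: dv|exact: dv'|exact: diverging_sym|idtac].
  + exact: diverging_inv.
  + exact/diverging_sym/diverging_inv.
- exact: start_ell hy.
- exact: start_ellV hy.
Qed.

End Foldings.

(** * Hyperbolic elements *)

Section GoodPairs.
Variable G : groupType.
Implicit Types s t h : G.

(** The two ways in which a hyperbolic element [s] and an element [t] that does
    not preserve its axis generate a free monoid cheaply. *)
Definition good_pair s t : Prop :=
  (exists s' t', [/\ s' = s \/ s' = s^-1, t' = t \/ t' = t^-1 &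
     free_family (duo s' (s' * t'))]) \/
  (t * t = 1 /\ free_family (duo s (t * s^-1 * t))).

Lemma good_pairV s t : good_pair s t^-1 -> good_pair s t.
Proof.
case=> [[s' [t' [es et F]]]|[tt F]]; [left|right].
  by exists s', t'; split=> //; case: et; rewrite ?invgK; [right|left].
have te : t = t^-1.
  by apply/esym/mulg1_eq/invg_inj; rewrite invgM tt invg1.
by rewrite te.
Qed.

Lemma good_pairVl s t : good_pair s^-1 t -> good_pair s t.
Proof.
case=> [[s' [t' [es et F]]]|[tt F]]; [left|right].
  by exists s', t'; split=> //; case: es; rewrite ?invgK; [right|left].
split=> //; apply: (free_inv _ F) => -[] /=; rewrite ?invgK //.
by rewrite !invgM !(involution_inv tt) mulgA.
Qed.

Lemma good_pair_conj h s t :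
  good_pair (h * s * h^-1) (h * t * h^-1) -> good_pair s t.
Proof.
have cV x : h^-1 * (h * x * h^-1) * h^-1^-1 = x.
  by rewrite invgK !mulgA mulVg mul1g mulgVK.
case=> [[s' [t' [es et F]]]|[tt F]]; [left|right].
  exists (h^-1 * s' * h^-1^-1), (h^-1 * t' * h^-1^-1); split.
  - by case: es => ->; rewrite ?conj_inv cV; [left|right].
  - by case: et => ->; rewrite ?conj_inv cV; [left|right].
  by apply: free_conj F => -[] //=; rewrite conj_mul.
split.
  apply: (@mulgI _ h); apply: (@mulIg _ h^-1).
  by rewrite -conj_mul tt mulg1 mulgV.
by apply: (free_conj (h := h^-1)) F => -[]; rewrite /= ?conj_inv ?conj_mul cV.
Qed.

End GoodPairs.

Section Hyperbolic.
Variables A B : groupType.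
Local Arguments reduced : simpl never.
Local Notation G := (freeprod A B).
Local Notation T := (A + B)%type.
Local Notation lt := (@freeprod_letter A B).
Local Notation side := (@letter_side A B).
Local Notation linv := (@letter_inv A B).
Implicit Types (b c : T) (w : seq T) (s t g h : G) (o : bool).

Lemma start_cons o g : start o g -> exists c w,
  [/\ val g = c :: w, side c = o, ~~ letter_trivial c, reduced w
    & ~~ starts o w /\ g = lt c * elt w].
Proof.
move=> sg; case E: (val g) (valP g) sg => [|c w]; rewrite /start E //=.
rewrite reduced_cons => /and3P[nc nw rw] /eqP co; exists c, w; split=> //; split.
  by rewrite -co.
by rewrite -(elt_val g) E elt_cons.
Qed.

Lemma start_rcons o g : start o g^-1 -> exists c w,
  [/\ val g = rcons w c, side c = o, ~~ letter_trivial c, reduced w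
    & ~~ starts o (word_inv w) /\ g = elt w * lt c].
Proof.
move=> /start_cons[c [w [E co nc rw [nw gE]]]].
exists (linv c), (word_inv w); split.
- rewrite -[val g]word_invK -valV E /word_inv /= rev_cons; congr rcons.
- by rewrite letter_side_inv.
- by rewrite letter_trivial_inv.
- exact: word_inv_reduced.
split; first by rewrite word_invK.
by rewrite -[g]invgK gE invgM freeprod_letterV eltV.
Qed.

Lemma start_elt o w : reduced w -> start o (elt w) = starts o w.
Proof. by move=> rw; rewrite /start val_elt. Qed.

Lemma start_eltV o w : reduced w -> start o (elt w)^-1 = starts o (word_inv w).
Proof.
by move=> rw; rewrite -eltV start_elt //; apply: word_inv_reduced.
Qed.

Lemma not_starts o w : w <> [::] -> ~~ starts o w -> starts (~~ o) w.
Proof. by case: w => //= c w _; case: (side c); case: o. Qed.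

Lemma word_inv_nil w : word_inv w = [::] -> w = [::].
Proof. by case: w => // x w /(congr1 size); rewrite size_word_inv. Qed.

(** The last letter of [s] merges with the first letter of [h] without
    cancelling it, so the product still starts like [s]. *)
Lemma start_merge o s h b c w w' :
  start o s -> start (~~ o) s^-1 -> start (~~ o) h ->
  val s = rcons w b -> val h = c :: w' -> b <> linv c -> start o (s * h).
Proof.
move=> ss sV sh E E' bc.
have [b' [w1 [E1 sb nb rw [nw sE]]]] := start_rcons sV.
move: E1 sb nb rw nw sE; rewrite E => /rcons_inj[<- <-] sb nb rw nw sE.
have [c' [w1' [E1' sc nc rw' [nw' hE]]]] := start_cons sh.
move: E1' sc nc rw' nw' hE; rewrite E' => -[<- <-] sc nc rw' nw' hE.
have bcs : side b = side c by rewrite sb sc.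
have [z [sz ez tz _ _]] := letter_merge bcs.
have nz : ~~ letter_trivial z by apply/negP => /tz.
have -> : s * h = elt w * elt (z :: w').
  by rewrite sE hE elt_cons -ez !mulgA.
have wn : w <> [::].
  by move=> w0; move: ss; rewrite /start E w0 /= sb; case: (o).
have rz : reduced (z :: w') by rewrite reduced_cons nz sz sb nw' rw'.
apply: (@start_mul _ _ o).
- rewrite start_eltV //; have := not_starts _ nw; rewrite negbK; apply.
  by move/word_inv_nil.
- by move: ss; rewrite start_elt // /start E; case: (w) wn.
by rewrite start_elt //= sz sb; case: (o).
Qed.

(** [t] maps the half-tree in front of the base edge behind it, and [s] brings the
    image back to the front without folding. *)
Lemma turn_good_merge o s t b c w w' :
  start o s -> start (~~ o) s^-1 -> start (~~ o) t -> start (~~ o) t^-1 ->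
  val s = rcons w b -> val t = c :: w' -> b <> linv c -> good_pair s t.
Proof.
move=> ss sV st tV E E' bc; left; exists s, t; split; [by left|by left|].
have tD h : start o h -> exists r, val (t * h) = c :: r.
  by move=> /start_flip sh; rewrite (val_mul tV sh) E'; eexists.
have stD h : start o h -> start (~~ o) (t * h).
  by move=> /start_flip sh; apply: start_mul tV st sh.
apply: (@ping_pong _ _ _ (start o)).
- by exists s.
- by move=> l; exists (~~ l); case: l.
- case=> h sh /=; first exact: start_mul sV ss (start_flip sh).
  rewrite -mulgA; have [r Er] := tD h sh.
  exact: start_merge ss sV (stD _ sh) E Er bc.
have nX h h' : start o h -> start o h' -> s * h <> s * t * h'.
  by move=> sh /stD /start_flip nh; rewrite -mulgA => /mulgI e;
     rewrite negbK -e sh in nh.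
by case=> [] [] h h' sh sh' //= e;
   [case: (nX _ _ sh sh' e)|case: (nX _ _ sh' sh (esym e))].
Qed.

(** If neither [t] nor its inverse can be used as before, [t] begins with the
    inverse of the last letter of [s] and ends with this letter.  Then either
    [t] gets shorter when the base edge is moved back along the axis, or [t] is
    this letter and an involution. *)
Lemma turn_good n o s t : (size (val t) < n)%N ->
  start o s -> start (~~ o) s^-1 -> start (~~ o) t -> start (~~ o) t^-1 ->
  t * s * t^-1 <> s^-1 -> good_pair s t.
Proof.
elim: n o s t => // n IH o s t tn ss sV st tV ts.
have [b [w [E sb nb rw [nw sE]]]] := start_rcons sV.
have [c [w' [E' sc nc rw' [nw' tE]]]] := start_cons st.
have [c' [w'' [E'' sc' nc' rw'' [nw'' tVE]]]] := start_cons tV.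
have [bc|/eqP bc] := eqVneq b (linv c); last exact: turn_good_merge ss sV st tV E E' bc.
have [bc'|/eqP bc'] := eqVneq b (linv c'); last first.
  by apply: good_pairV; apply: (turn_good_merge ss sV tV _ E E'' bc'); rewrite ?invgK.
have wn : w <> [::].
  by move=> w0; move: ss; rewrite /start E w0 /= sb; case: (o).
have swV : starts o (word_inv w).
  by have := not_starts _ nw; rewrite negbK; apply => /word_inv_nil.
have sw : starts o w by move: ss; rewrite /start E; case: (w) wn.
have Et : val t = rcons (word_inv w'') b.
  by rewrite -[val t]word_invK -valV E'' /word_inv /= rev_cons -bc'.
case/lastP: w' E' rw' nw' tE => [|m b'] E' rw' nw' tE.
  have tb : t = lt b.
    move: Et; rewrite E' => /(congr1 (last c)) /=; rewrite last_rcons => cb.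
    by rewrite tE elt_nil mulg1 cb.
  have tt : t * t = 1.
    rewrite {2}tE elt_nil mulg1 tb bc freeprod_letterV mulVg //.
  pose x := elt w; have sx : s = x * t by rewrite sE tb.
  have tsV : t * s^-1 * t = x^-1 * t.
    by rewrite sx invgM (involution_inv tt) !mulgA tt mul1g.
  right; split=> //; rewrite tsV sx.
  have startx : start o x by rewrite start_elt.
  have startxV : start o x^-1 by rewrite start_eltV.
  have vx : val x = w by rewrite val_elt.
  have vxV : val x^-1 = word_inv w by rewrite valV vx.
  have stD h : start o h -> ~~ start o (t * h).
    by move=> /start_flip sh; have := start_flip (start_mul tV st sh); rewrite negbK.
  have nX h h' : start o h -> start o h' -> x * t * h <> x^-1 * t * h'.
    move=> sh sh' /(congr1 val); rewrite -!mulgA (val_mul startxV (stD _ sh)).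
    have xVV : start o x^-1^-1 by rewrite invgK.
    rewrite (val_mul xVV (stD _ sh')) vx vxV => /(congr1 (take (size w))).
    rewrite take_size_cat // take_size_cat ?size_word_inv // => ww.
    have xx : x^-1 = x by rewrite /x -eltV -ww.
    by apply: ts; rewrite sx invgM (involution_inv tt) xx mulgA (involution_cancel tt).
  apply: (@ping_pong _ _ _ (start o)).
  - by exists x.
  - by move=> l; exists (~~ l); case: l.
  - case=> h sh /=; rewrite -mulgA.
      exact: start_mul startxV startx (stD _ sh).
    by apply: (start_mul _ startxV (stD _ sh)); rewrite invgK.
  by case=> [] [] h h' sh sh' //= e;
   [case: (nX _ _ sh sh' e)|case: (nX _ _ sh' sh (esym e))].
have bb : b' = b.
  by move: Et; rewrite E' -rcons_cons => /rcons_inj[].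
rewrite bb in E' rw' nw' tE.
have rm : reduced m by move: rw'; rewrite -cats1 => /reduced_catl.
have hrm : half (side (head b m)) m b by rewrite /half rw' eqxx.
have nmV : ~~ starts (~~ o) (word_inv m).
  by move: hrm; rewrite halfE -sb => /and4P[].
have mn : m <> [::].
  by move=> m0; move: nw'; rewrite m0 /= sb eqxx.
have sm : starts o m.
  have := not_starts mn (o := ~~ o); rewrite negbK; apply.
  by move: nw'; case: (m) mn.
have smV : starts o (word_inv m).
  by have := not_starts _ nmV; rewrite negbK; apply => /word_inv_nil.
have ecb : lt c = (lt b)^-1 by rewrite bc freeprod_letterV invgK.
have t'E : lt b * t * (lt b)^-1 = elt m.
  by rewrite tE ecb -cats1 elt_cat elt1 !mulgA mulgV mul1g mulgK.
have s'E : lt b * s * (lt b)^-1 = elt (b :: w).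
  by rewrite sE elt_cons !mulgA mulgK.
have rbw : reduced (b :: w).
  by rewrite reduced_cons nb rw andbT sb; apply: starts_flip.
apply: (@good_pair_conj _ (lt b)).
apply: (IH (~~ o)); rewrite ?t'E ?s'E ?negbK.
- by rewrite val_elt //; move: tn; rewrite E' /= size_rcons ltnS => /ltnW.
- by rewrite start_elt //= sb.
- by rewrite start_eltV // -cat1s word_inv_cat starts_cat.
- by rewrite start_elt.
- by rewrite start_eltV.
by rewrite -t'E -s'E !conj_inv !conj_mul => /mulIg/mulgI.
Qed.

(** If [s] and [t] translate in the same direction, move the base point along
    their common axis until it branches. *)
Lemma parallel_good n o s t :
  start o s -> start (~~ o) s^-1 -> start o t -> start (~~ o) t^-1 ->
  take n (val s ++ val t) <> take n (val t ++ val s) ->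
  t * s * t^-1 <> s^-1 -> good_pair s t.
Proof.
elim: n o s t => [|n IH] o s t ss sV st tV; first by rewrite !take0.
have [c [w [E sc nc rw [nw sE]]]] := start_cons ss.
have [c' [w' [E' sc' nc' rw' [nw' tE]]]] := start_cons st.
rewrite E E' /= => tk ts.
have wV x v (y : G) : val y = x :: v -> start (~~ o) y^-1 -> side x = o ->
    v <> [::] /\ starts (~~ o) (word_inv v).
  rewrite /start valV => -> + sx; case/lastP: v => [|v z].
    by rewrite /= letter_side_inv sx; case: (o).
  rewrite -rcons_cons !word_inv_rcons /= => ->; split=> //.
  by case: v.
have [wn sw] := wV _ _ _ E sV sc; have [wn' sw'] := wV _ _ _ E' tV sc'.
have sw1 := not_starts wn nw; have sw1' := not_starts wn' nw'.
have conj (g : G) v : g = lt c * elt v -> (lt c)^-1 * g * (lt c)^-1^-1 = elt (rcons v c).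
  by move=> ->; rewrite invgK mulKg -cats1 elt_cat elt1.
have rc v : reduced v -> starts (~~ o) (word_inv v) -> reduced (rcons v c).
  move=> rv sv; rewrite -cats1; apply: reduced_cat sv _ => //.
    by rewrite reduced_cons nc.
  by rewrite /= sc; case: (o).
have s' : (lt c)^-1 * s * (lt c)^-1^-1 = elt (rcons w c) by apply: conj.
have ts' : (lt c)^-1 * t * (lt c)^-1^-1 * ((lt c)^-1 * s * (lt c)^-1^-1) *
    ((lt c)^-1 * t * (lt c)^-1^-1)^-1 <> ((lt c)^-1 * s * (lt c)^-1^-1)^-1.
  by rewrite conj_inv !conj_mul conj_inv => /mulIg/mulgI.
have ends v : starts o (word_inv (rcons v c)).
  by rewrite word_inv_rcons /= letter_side_inv sc.
have st1 v : starts (~~ o) v -> starts (~~ o) (rcons v c).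
  by rewrite -cats1; apply: starts_cat.
apply: (@good_pair_conj _ (lt c)^-1).
have [cc|cc] := eqVneq c c'.
  have t' : (lt c)^-1 * t * (lt c)^-1^-1 = elt (rcons w' c).
    by apply: conj; rewrite tE cc.
  rewrite s' t' in ts' *; apply: (IH (~~ o)) => //; rewrite ?negbK.
  - by rewrite start_elt ?rc // st1.
  - by rewrite start_eltV ?rc // ends.
  - by rewrite start_elt ?rc // st1.
  - by rewrite start_eltV ?rc // ends.
  rewrite !val_elt ?rc // => e; apply: tk; rewrite -cc; congr (_ :: _).
  have tX X Y : size X = size Y -> take n (rcons X c) = take n (rcons Y c) ->
      take n X = take n Y.
    have tk' Z : take n Z = take (size Z) (take n (rcons Z c)).
      by rewrite -take_min minnC take_min -cats1 take_size_cat.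
    by move=> XY e'; rewrite (tk' X) (tk' Y) e' XY.
  apply: tX; first by rewrite !size_cat /= !addnS addnC.
  by move: e; rewrite -!rcons_cat !cat_rcons.
have cs : side (linv c) = side c' by rewrite letter_side_inv sc sc'.
have [z [sz ez tz _ _]] := letter_merge cs.
have nz : ~~ letter_trivial z.
  by apply/negP => /tz /(inv_inj (@letter_invK A B)) e; rewrite e eqxx in cc.
have t' : (lt c)^-1 * t * (lt c)^-1^-1 = elt (z :: rcons w' c).
  rewrite tE -freeprod_letterV !mulgA ez freeprod_letterV invgK elt_cons.
  by rewrite -cats1 elt_cat elt1 !mulgA.
have rz : reduced (z :: rcons w' c).
  rewrite reduced_cons nz rc // andbT sz letter_side_inv sc.
  by have := starts_flip (st1 _ sw1'); rewrite negbK.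
rewrite s' t' in ts' *; apply: (turn_good (ltnSn _) (o := ~~ o)) => //; rewrite ?negbK.
- by rewrite start_elt ?rc // st1.
- by rewrite start_eltV ?rc // ends.
- by rewrite start_elt //= sz letter_side_inv sc.
- by rewrite start_eltV // -rcons_cons ends.
Qed.

Lemma even_sides s : (0 < size (val s))%N -> ~~ odd (size (val s)) ->
  exists o, start o s /\ start (~~ o) s^-1.
Proof.
move=> s0 se; case E: (val s) (valP s) s0 se => [//|c w] rs _ /=.
rewrite negbK (reduced_parity rs) => lc; exists (side c); split.
  by rewrite /start E /= eqxx.
rewrite /start valV E.
move: lc; case/lastP: (w) => [|v x]; first by rewrite /= eqxx.
rewrite last_rcons -rcons_cons word_inv_rcons /= letter_side_inv.
by case: (side x); case: (side c).
Qed.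

(** Up to inverting [s] or [t], the word of [t] turns around at the base edge or
    is parallel to that of [s]. *)
Lemma hyperbolic_good s t : (0 < size (val s))%N -> ~~ odd (size (val s)) ->
  t * s <> s * t -> t * s * t^-1 <> s^-1 -> good_pair s t.
Proof.
move=> s0 se ts ts'.
have [q [ss sV]] := even_sides s0 se.
have t1 : t <> 1 by move=> t1; apply: ts; rewrite t1 mulg1 mul1g.
have vdiff (y : G) : y * s <> s * y -> start q y -> start (~~ q) y^-1 ->
    take (size (val s ++ val y)) (val s ++ val y) <>
    take (size (val s ++ val y)) (val y ++ val s).
  move=> sy oy yV; rewrite take_size take_oversize; last by rewrite !size_cat addnC.
  rewrite -(val_mul sV (start_flip oy)) -(val_mul yV (start_flip ss)).
  by move/val_inj => e; apply: sy.
have [q1 st] := startP t1; have [q2 tV] := start_inv_ex t1.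
have flip (b b' : bool) : b = b' \/ b = ~~ b'.
  by case: b b' => [] []; [left|right|right|left].
have [e1|e1] := flip q1 q; have [e2|e2] := flip q2 q; rewrite {}e1 {}e2 in st tV.
- apply: good_pairVl; apply: (turn_good (ltnSn _) (o := ~~ q)) => //;
    rewrite ?negbK ?invgK // => e; apply: ts'.
  by rewrite -[in RHS]e conj_inv invgK.
- exact: parallel_good ss sV st tV (vdiff t ts st tV) ts'.
- apply: good_pairV; rewrite -[t]invgK in st.
  apply: (parallel_good ss sV tV st (vdiff _ _ tV st)) => e.
    by apply: ts; rewrite -{1}[s](mulgVK t s) -e !mulgA mulgV mul1g.
  have e' : s = t^-1 * s^-1 * t^-1^-1.
    by apply: invg_inj; rewrite conj_inv [s^-1^-1]invgK e.
  by apply: ts'; rewrite {1}e' invgK !mulgA mulgV mul1g mulgK.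
- exact: turn_good (ltnSn _) ss sV st tV ts'.
Qed.

End Hyperbolic.

(** * Recognizing free products of small cyclic groups *)

Section Cyclic.
Variable H : groupType.
Implicit Types x : H.

Lemma expg_mod_order x k n : x ^+ k = 1 -> x ^+ (n %% k) = x ^+ n.
Proof.
by move=> xk; rewrite {2}(divn_eq n k) expgnDr mulnC expgnA xk expg1n mul1g.
Qed.

Lemma C2_morphism x : x * x = 1 ->
  exists f : {multiplicative C2 -> H}, forall i, i <> 1 -> f i = x.
Proof.
move=> xx; pose f (i : C2) : H := x ^+ (i : 'Z_2).
have fM : {morph f : i j / i * j}.
  by move=> i j; rewrite /f -expgnDr; apply: (@expg_mod_order x 2).
pose ff : {multiplicative C2 -> H} :=
  HB.pack f (isMultiplicative.Build C2 H f fM).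
exists ff => i i1 /=.
rewrite /f; case: i i1 => [[|[|]]] //= lt i1.
by case: i1; apply: val_inj.
Qed.

Lemma C3_morphism x : x * x * x = 1 ->
  exists f : {multiplicative C3 -> H}, forall i, i <> 1 -> f i = x \/ f i = x^-1.
Proof.
move=> xx; pose f (i : C3) : H := x ^+ (i : 'Z_3).
have x3 : x ^+ 3 = 1 by rewrite !expgS expg0 mulg1 mulgA.
have fM : {morph f : i j / i * j}.
  by move=> i j; rewrite /f -expgnDr; apply: (@expg_mod_order x 3).
pose ff : {multiplicative C3 -> H} :=
  HB.pack f (isMultiplicative.Build C3 H f fM).
exists ff => i i1 /=.
rewrite /f; case: i i1 => [[|[|[|]]]] //= lt i1; [|by left|right].
  by case: i1; apply: val_inj.
by apply: esym; apply: mulg1_eq; rewrite -expgS.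
Qed.

End Cyclic.

Section Isomorphism.
Variables A B : groupType.
Local Arguments reduced : simpl never.
Local Notation G := (freeprod A B).
Implicit Types (s g h : G) (o : bool).

(** A pair of morphisms whose nontrivial values start and end on opposite sides
    sends reduced words to products without any cancellation. *)
Lemma freeprod_iso (C D : groupType)
    (f : {multiplicative C -> G}) (g : {multiplicative D -> G}) o :
  (forall c, c <> 1 -> start o (f c) /\ start o (f c)^-1) ->
  (forall d, d <> 1 -> start (~~ o) (g d) /\ start (~~ o) (g d)^-1) ->
  (forall P : G -> Prop, P 1 -> (forall a b, P a -> P b -> P (a * b)) ->
     (forall c, P (f c)) -> (forall d, P (g d)) -> forall u, P u) ->
  isomorphic_groups G (freeprod C D).
Proof.
move=> fS gS gen; have [h [hf hg]] := freeprod_lift f g.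
pose tau (x : C + D) := if letter_side x then o else ~~ o.
have hx x : ~~ letter_trivial x ->
    start (tau x) (h (freeprod_letter x)) /\ start (tau x) (h (freeprod_letter x))^-1.
  case: x => [c|d] /= /eqP n1.
    by rewrite -/(freeprod_inl D c) hf; apply: fS.
  by rewrite -/(freeprod_inr C d) hg; apply: gS.
have h1 : h 1 = 1 by apply: (@mulgI _ (h 1)); rewrite -gmulfM !mulg1.
have key w x : reduced (x :: w) -> start (tau x) (h (elt (x :: w))).
  elim: w x => [|y w IH] x; rewrite reduced_cons => /and3P[nx nw rw].
    by rewrite elt1; case: (hx x nx).
  have [sx sxV] := hx x nx; rewrite elt_cons gmulfM; apply: start_mul sxV sx _.
  have := start_flip (IH y rw); move: nw; rewrite /tau /=.
  by case: (letter_side y); case: (letter_side x) => //= _; rewrite ?negbK.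
have hI : injective h.
  have ker u : h u = 1 -> u = 1.
    move=> hu; apply: val_inj; rewrite -(elt_val u) in hu.
    case: (val u) (valP u) hu => // x w rw hu.
    by have := start_neq1 (key w x rw).
  move=> u v huv; apply: (@mulIg _ v^-1); rewrite mulgV; apply: ker.
  by rewrite gmulfM huv -gmulfM mulgV.
have hsurj u : exists v, h v = u.
  apply: (gen (fun u => exists v, h v = u)) => [|a b [v <-] [w <-]|c|d].
  - by exists 1.
  - by exists (v * w); rewrite gmulfM.
  - by exists (freeprod_inl D c).
  - by exists (freeprod_inr C d).
pose k u := projT1 (cid (hsurj u)).
have hk u : h (k u) = u by rewrite /k; case: cid.
have kM : {morph k : u v / u * v} by move=> u v; apply: hI; rewrite gmulfM !hk.
pose kk : {multiplicative G -> freeprod C D} :=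
  HB.pack k (isMultiplicative.Build G (freeprod C D) k kM).
by exists kk; exists h => [u|v]; [exact: hk|apply: hI; rewrite hk].
Qed.

Local Notation lt := (@freeprod_letter A B).
Local Notation side := (@letter_side A B).
Local Notation linv := (@letter_inv A B).

(** Conjugation by a letter different from the inverse of the first letter of
    [s] changes the parity of the length. *)
Lemma normalized_letters o s : start o s -> start (~~ o) s^-1 ->
  (forall g, g * s * g^-1 = s \/ g * s * g^-1 = s^-1) ->
  exists c, [/\ side c = o, ~~ letter_trivial c, linv c = c
             & forall a, side a = o -> ~~ letter_trivial a -> a = c].
Proof.
move=> ss sV ns; have [c [w [E sc nc rw [nw sE]]]] := start_cons ss.
have key a : side a = o -> ~~ letter_trivial a -> a = linv c.
  move=> sa na; apply/eqP/negPn/negP => /eqP ac.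
  have sac : side a = side c by rewrite sa sc.
  have [z [sz ez tz _ _]] := letter_merge sac.
  have nz : ~~ letter_trivial z by apply/negP => /tz.
  have rz : reduced (z :: w) by rewrite reduced_cons nz sz sa nw rw.
  have asE : lt a * s = elt (z :: w) by rewrite sE mulgA ez elt_cons.
  have wV : starts (~~ o) (word_inv w).
    move: sV; rewrite /start valV E; case/lastP: (w) => [|v x].
      by rewrite /= letter_side_inv sc; case: (o).
    by rewrite -rcons_cons !word_inv_rcons.
  have sz1 : size (val (lt a * s * (lt a)^-1)) = (size (val s)).+1.
    rewrite asE (@val_mul _ _ (~~ o)).
    - rewrite val_elt // -freeprod_letterV val_letter ?letter_trivial_inv //.
      by rewrite size_cat E /= addn1.
    - by rewrite start_eltV // -cat1s word_inv_cat starts_cat.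
    by apply: start_flip; rewrite -sa; apply: start_letterV.
  have [e|e] := ns (lt a); move: sz1; rewrite e ?valV ?size_word_inv => /eqP;
    by rewrite eqn_leq ltnn andbF.
have cc := key c sc nc; exists c; split=> // a sa na.
by rewrite (key a sa na) -cc.
Qed.

(** Both sides have a single nontrivial letter. *)
Lemma normal_axis_dihedral o s : start o s -> start (~~ o) s^-1 ->
  (forall g, g * s * g^-1 = s \/ g * s * g^-1 = s^-1) ->
  isomorphic_groups G (freeprod C2 C2).
Proof.
move=> ss sV ns; have [c [sc nc cc uc]] := normalized_letters ss sV ns.
have [||d [sd nd dd ud]] := @normalized_letters (~~ o) s^-1 sV.
- by rewrite negbK invgK.
- by move=> g; rewrite -conj_inv; have [->|->] := ns g; rewrite ?invgK; [left|right].
have inv_letter x : linv x = x -> lt x * lt x = 1.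
  by move=> xx; rewrite -{1}xx freeprod_letterV mulVg.
have [f fP] := C2_morphism (inv_letter c cc).
have [g gP] := C2_morphism (inv_letter d dd).
have i1 : (1 : 'Z_2)%R <> 1 :> C2 by [].
apply: (@freeprod_iso _ _ f g o).
- by move=> i /fP->; rewrite -sc; split; [apply: start_letter|apply: start_letterV].
- by move=> i /gP->; rewrite -sd; split; [apply: start_letter|apply: start_letterV].
move=> P P1 PM Pf Pg u; rewrite (freeprodE u).
elim: (val u) (valP u) => [|x w IH]; first by rewrite big_nil.
rewrite reduced_cons => /and3P[nx _ /IH Pw]; rewrite big_cons; apply: PM Pw.
have [sx|sx] := eqVneq (side x) o.
  by rewrite (uc x sx nx) -(fP _ i1).
have {}sx : side x = ~~ o by move: sx; case: (side x); case: (o).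
by rewrite (ud x sx nx) -(gP _ i1).
Qed.

End Isomorphism.

Local Close Scope group_scope.
Local Open Scope ring_scope.

(** * Counting elements of balls *)

Section WeightedPaths.
Variables (L : eqType) (ls : seq L) (cost : L -> L -> nat).
Implicit Types (l : L) (w : seq L).

(** [cost l l'] is the price of the letter [l'] after [l]; the price 0 marks
    a forbidden transition. *)
Fixpoint weight l w : nat :=
  if w is l' :: w' then (cost l l' + weight l' w')%N else 0.

Fixpoint allowed l w : bool :=
  if w is l' :: w' then (0 < cost l l')%N && allowed l' w' else true.

Fixpoint paths (k : nat) l (n : nat) : seq (seq L) :=
  [::] :: if k is k'.+1 then
    flatten [seq if (0 < cost l l' <= n)%N
                 then map (cons l') (paths k' l' (n - cost l l')) else [::]
            | l' <- ls]
  else [::].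

Lemma pathsP k l n w :
  w \in paths k l n -> allowed l w && (weight l w <= n)%N.
Proof.
elim: k l n w => [|k IH] l n w /=; rewrite in_cons => /orP[/eqP->|] //.
case/flatten_mapP => l' _; case: ifP => // /andP[c0 cn] /mapP[w' /IH + ->] /=.
by rewrite c0 /= => /andP[-> /=]; rewrite leq_subRL.
Qed.

Lemma paths_uniq k l n : uniq ls -> uniq (paths k l n).
Proof.
move=> uls; elim: k l n => [//|k IH] l n; rewrite /paths -/paths cons_uniq.
apply/andP; split.
  apply/negP => /flatten_mapP[l' _]; case: ifP => // _ /mapP[] //.
elim: ls uls => //= a s IHs /andP[na us]; rewrite cat_uniq IHs // andbT.
apply/andP; split; first by case: ifP => // _; rewrite map_inj_uniq // => x y [].
apply/hasPn => w /flatten_mapP[l' l's]; case: ifP => // _ /mapP[w' _ ->].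
case: ifP => // _; apply/negP => /mapP[w'' _ [e]].
by move: na; rewrite -e l's.
Qed.

(** [v] is a subsolution of the eigenvector equation of the transfer operator
    for the growth factor [q]. *)
Lemma size_paths (R : realType) (q : R) (v : L -> R) M k l n :
  1 <= q -> (forall l, 0 <= v l <= 1) ->
  (forall l l', (cost l l' <= M)%N) ->
  (forall l, v l <= \sum_(l' <- ls | (0 < cost l l')%N)
                       v l' / q ^+ cost l l') ->
  (n <= k)%N ->
  v l * q ^+ n <= q ^+ M * (size (paths k l n))%:R.
Proof.
move=> q1 v01 cM vP.
have q0 : 0 < q by apply: lt_le_trans q1.
have qX m : 0 < q ^+ m by rewrite exprn_gt0.
have small l' m s : (m <= M)%N ->
    v l' * q ^+ m <= q ^+ M * (size ([::] :: s : seq (seq L)))%:R.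
  move=> mM; apply: (@le_trans _ _ (q ^+ M)).
    rewrite -[leRHS]mul1r ler_pM ?(ltW (qX _)) ?(andP (v01 l')).1 //.
      by have /andP[] := v01 l'.
    by rewrite ler_weXn2l.
  by rewrite ler_peMr ?(ltW (qX _)) // ler1n.
elim: k l n => [|k IH] l n nk.
  by move: nk; rewrite leqn0 => /eqP->; apply: small.
have [nM|Mn] := leqP n M; first exact: small.
apply: (@le_trans _ _ (\sum_(l' <- ls | (0 < cost l l')%N)
                       v l' * q ^+ (n - cost l l'))).
  apply: (@le_trans _ _ ((\sum_(l' <- ls | (0 < cost l l')%N)
                       v l' / q ^+ cost l l') * q ^+ n)).
    by rewrite ler_wpM2r ?(ltW (qX _)).
  rewrite mulr_suml ler_sum // => l' c0; rewrite -mulrA.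
  rewrite (_ : q ^- cost l l' * q ^+ n = q ^+ (n - cost l l')) //.
  have cn : (cost l l' <= n)%N by apply: leq_trans (cM _ _) (ltnW Mn).
  by rewrite -[in q ^+ n](subnKC cn) exprD mulrA mulVf ?mul1r // gt_eqF.
rewrite /paths -/paths /= -natr1 mulrDr mulr1.
apply: ler_wpDr; first by rewrite ltW.
elim: ls => [|a s IHs] /=; first by rewrite big_nil mulr0.
rewrite big_cons size_cat natrD mulrDr.
have -> : (0 < cost l a <= n)%N = (0 < cost l a)%N.
  by rewrite (leq_trans (cM _ _) (ltnW Mn)) andbT.
case: ifP => [c0|_]; last by rewrite mulr0 add0r.
apply: lerD => //; rewrite size_map; apply: IH.
by rewrite leq_subLR; apply: leq_trans nk _; rewrite -addn1 addnC leq_add2r.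
Qed.

End WeightedPaths.

Section Balls.
Variable G : groupType.
Implicit Types (S : {fset G}) (g h : G) (n : nat).

Definition expr_le S n g := exists2 m, (m <= n)%N & expressible S g m.

Lemma expr_le_one S n : expr_le S n 1%g.
Proof. by exists 0%N => //; exists [::]; rewrite big_nil. Qed.

Lemma expr_leW S m n g : (m <= n)%N -> expr_le S m g -> expr_le S n g.
Proof. by move=> mn [k km kg]; exists k => //; apply: leq_trans mn. Qed.

Lemma expr_leM S m n g h :
  expr_le S m g -> expr_le S n h -> expr_le S (m + n) (g * h)%g.
Proof.
move=> [k km [s [ks sS ->]]] [k' kn [t [kt tS ->]]].
exists (size s + size t)%N; first by rewrite ks kt leq_add.
exists (s ++ t); rewrite size_cat big_cat; split=> // x.
by rewrite mem_cat => /orP[/sS|/tS].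
Qed.

Lemma expr_leV S n g : expr_le S n g -> expr_le S n (g^-1)%g.
Proof.
move=> [k km [s [ss sS ->]]]; exists k => //.
exists (rev [seq (x^-1)%g | x <- s]); split.
- by rewrite size_rev size_map.
- move=> x; rewrite mem_rev => /mapP[y /sS yS ->]; rewrite invgK.
  by case: yS; [right|left].
elim: s {ss sS} => [|x s IH]; first by rewrite !big_nil invg1.
by rewrite big_cons invgM IH /= rev_cons -cats1 big_cat big_seq1.
Qed.

Lemma expr_le_gen S g : g \in S -> expr_le S 1 g.
Proof.
move=> gS; exists 1%N => //; exists [:: g]; rewrite big_seq1; split=> // x.
by rewrite inE => /eqP->; left.
Qed.

Lemma gen_ind S (P : G -> Prop) : generates S -> P 1%g ->
  (forall g h, P g -> P h -> P (g * h)%g) ->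
  (forall g, g \in S -> P g /\ P (g^-1)%g) -> forall g, P g.
Proof.
move=> gS P1 PM PS g; have [n [s [_ sS ->]]] := gS g.
elim: s sS => [|x s IH] sS; first by rewrite big_nil.
rewrite big_cons; apply: PM; last first.
  by apply: IH => y ys; apply: sS; rewrite inE ys orbT.
case: (sS x (mem_head _ _)) => /PS[] //.
by rewrite invgK.
Qed.

Lemma ballE S n g : generates S -> Defs.ball S n g <-> expr_le S n g.
Proof.
move=> gS; have [ex mi] := word_lengthP g gS; split=> [gn|[m mn /mi lm]].
  by exists (word_length S g).
exact: leq_trans mn.
Qed.

Lemma leq_growth S n (s : seq G) : generates S -> uniq s ->
  (forall g, g \in s -> expr_le S n g) -> (size s <= growth S n)%N.
Proof.
move=> gS us sn; apply: uniq_leq_size => // g /sn gn.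
rewrite in_fset_set; last exact: ball_finite.
by apply/mem_set/(ballE _ _ gS).
Qed.

Lemma ball_enum S n : generates S -> exists s : seq G,
  [/\ uniq s, size s = growth S n & forall g, g \in s <-> expr_le S n g].
Proof.
move=> gS; exists (enum_fset (fset_set (Defs.ball S n))); split; first exact: fset_uniq.
  by [].
move=> g; rewrite in_fset_set; last exact: ball_finite.
by rewrite -ballE //; split => [/set_mem|/mem_set].
Qed.

Lemma growth_gt0 S n : generates S -> (0 < growth S n)%N.
Proof.
move=> gS; apply: (@leq_growth S n [:: 1%g]) => // g.
by rewrite inE => /eqP->; apply: expr_le_one.
Qed.

Lemma leq_growth2 S m n : generates S -> (m <= n)%N ->
  (growth S m <= growth S n)%N.
Proof.
move=> gS mn; have [s [us <- sP]] := ball_enum m gS.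
by apply: leq_growth => // g /sP; apply: expr_leW.
Qed.

Lemma expr_le_split S m n g : expr_le S (m + n) g ->
  exists a b, [/\ expr_le S m a, expr_le S n b & g = (a * b)%g].
Proof.
move=> [k km [s [ks sS ->]]].
exists (\prod_(x <- take m s) x)%g, (\prod_(x <- drop m s) x)%g; split.
- exists (size (take m s)); first by rewrite size_take; case: ltnP.
  by exists (take m s); split=> // x /mem_take /sS.
- exists (size (drop m s)); first by rewrite size_drop leq_subLR ks.
  by exists (drop m s); split=> // x /mem_drop /sS.
by rewrite -big_cat cat_take_drop.
Qed.

Lemma growthD S m n : generates S ->
  (growth S (m + n) <= growth S m * growth S n)%N.
Proof.
move=> gS; have [s [us <- sP]] := ball_enum m gS.
have [t [ut <- tP]] := ball_enum n gS.
have [r [ur <- rP]] := ball_enum (m + n) gS.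
rewrite -(size_allpairs (fun x y => (x * y)%g)); apply: uniq_leq_size => //.
move=> g /rP /expr_le_split[a [b [/sP aS /tP bT ->]]].
by apply/allpairsP; exists (a, b).
Qed.

End Balls.

(** * The growth rate as a limit *)

Section Limits.
Local Open Scope classical_set_scope.
Variable R : realType.

Lemma cvg_root (c : R) : 0 < c -> c `^ n%:R^-1 @[n --> \oo] --> (1 : R).
Proof.
move=> c0; rewrite -[1 in X in _ --> X]expR0.
have E n : expR (n%:R^-1 * ln c) = c `^ n%:R^-1 by rewrite /powR gt_eqF.
under eq_fun do rewrite -E.
apply: (@continuous_cvg _ _ _ _ _ _ expR 0); first exact: continuous_expR.
rewrite -[X in _ --> X](mul0r (ln c)); apply: cvgMr_tmp.
apply/gtr0_cvgV0; last exact: cvgr_idn.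
by exists 1%N => // n /=; rewrite ltr0n.
Qed.

(** Fekete's lemma in multiplicative form.  For a nondecreasing sequence,
    rounding [n] up to a multiple of [m] bounds the n-th root by the m-th one
    up to a factor that tends to 1. *)
Lemma submultiplicative_root_cvg (F : nat -> nat) :
  (forall n, (0 < F n)%N) -> {homo F : m n / (m <= n)%N} ->
  (forall m n, (F (m + n) <= F m * F n)%N) ->
  cvg ((F n)%:R `^ n%:R^-1 @[n --> \oo] : set_system R).
Proof.
move=> F0 Fm FD; pose a n : R := (F n)%:R `^ n%:R^-1.
have F1 n : 1 <= (F n)%:R :> R by rewrite ler1n.
have Fgt n : 0 < (F n)%:R :> R by rewrite ltr0n.
pose E := [set a n | n in [set n | (0 < n)%N]].
have E1 : lbound E 0 by move=> _ [n _ <-]; apply: powR_ge0.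
have hE : has_inf E by split; [exists (a 1%N); exists 1%N|exists 0].
have FX m k : (F (m * k.+1) <= F m ^ k.+1)%N.
  elim: k => [|k IH]; first by rewrite muln1 expn1.
  by rewrite mulnS expnS (leq_trans (FD _ _)) // leq_mul2l IH orbT.
have am m n : (0 < m)%N -> (0 < n)%N -> a n <= a m * (F m)%:R `^ n%:R^-1.
  move=> m0 n0; rewrite /a -powRD; last by rewrite (gt_eqF (Fgt m)) implybT.
  have n0R : 0 < n%:R :> R by rewrite ltr0n.
  have m0R : 0 < m%:R :> R by rewrite ltr0n.
  apply: (@le_trans _ _ (((F m) ^ (n %/ m).+1)%N%:R `^ n%:R^-1)).
    apply: ge0_ler_powR; rewrite ?nnegrE ?ler0n ?invr_ge0 //.
    rewrite ler_nat (leq_trans _ (FX _ _)) // Fm // mulnC.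
    by rewrite ltnW // ltn_ceil.
  rewrite natrX -powR_mulrn ?ler0n // -powRrM; apply: ler_powR => //.
  rewrite -natr1 mulrDl mul1r lerD2r ler_pdivrMr // mulrC ler_pdivlMr //.
  by rewrite -natrM ler_nat leq_trunc_div.
apply/cvg_ex; exists (inf E); apply/cvgrPdist_lt => e e0.
have [_ [m /= m0 <-] ame] := inf_adherent e0 hE.
have bm : a m * (F m)%:R `^ n%:R^-1 @[n --> \oo] --> a m.
  by rewrite -[X in _ --> X]mulr1; apply: cvgMl_tmp; apply: cvg_root.
have nb := cvgr_lt (a m) bm (inf E + e) ame.
apply: (filterS2 _ _ (nbhs_infty_gt 0) (nb _)) => n n0 bn.
have la : inf E <= a n by apply: ge_inf; [exists 0|exists n].
rewrite distrC ger0_norm ?subr_ge0 // ltrBlDl.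
by apply: le_lt_trans bn; apply: am.
Qed.

End Limits.

(** * Golden growth *)

Section Golden.
Variable R : realType.

Definition phi : R := (1 + Num.sqrt 5) / 2.

Lemma phi2 : phi ^+ 2 = phi + 1.
Proof.
rewrite /phi; have := sqr_sqrtr (ler0n R 5); set r := Num.sqrt 5 => r2.
by rewrite expr2; field: r2.
Qed.

Lemma phi_gt1 : 1 < phi.
Proof.
rewrite /phi ltr_pdivlMr // mul1r -[X in X < _]/(1 + 1) ltrD2l.
by rewrite -[X in X < _]sqrtr1 ltr_sqrt ?ltr1n.
Qed.

Lemma phi_gt0 : 0 < phi.
Proof. exact: lt_trans phi_gt1. Qed.

Definition golden (G : groupType) (S : {fset G}) : Prop :=
  exists2 kC : R * nat, 0 < kC.1 &
    forall n, kC.1 * phi ^+ n <= (growth S (n + kC.2))%:R.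

Lemma growth_rate_golden (G : groupType) (S : {fset G}) :
  generates S -> golden S -> phi <= growth_rate R S.
Proof.
move=> gS [[k C] /= k0 kC]; rewrite /growth_rate.
have p0 := phi_gt0; pose c := k / phi ^+ C.
have c0 : 0 < c by rewrite divr_gt0 ?exprn_gt0.
have lim_c : (phi * c `^ n%:R^-1 @[n --> \oo] --> phi)%classic.
  by rewrite -[X in (_ --> X)%classic]mulr1; apply: cvgMl_tmp; apply: cvg_root.
apply: (ler_cvg_to lim_c).
  apply: submultiplicative_root_cvg => [n|m n|m n].
  - exact: growth_gt0.
  - exact: leq_growth2.
  - exact: growthD.
apply: (filterS2 _ _ (nbhs_infty_gt 0) (nbhs_infty_ge C)) => n n0 Cn.
have -> : phi * c `^ n%:R^-1 = (phi ^+ n * c) `^ n%:R^-1.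
  rewrite powRM ?exprn_ge0 ?(ltW p0) ?(ltW c0) // -powR_mulrn ?(ltW p0) //.
  by rewrite -powRrM mulfV ?powRr1 ?(ltW p0) // pnatr_eq0 -lt0n.
apply: ge0_ler_powR; rewrite ?invr_ge0 ?nnegrE ?ler0n //.
  by rewrite mulr_ge0 ?exprn_ge0 ?(ltW p0) ?(ltW c0).
have := kC (n - C)%N; rewrite /= subnK //; apply: le_trans.
rewrite /c -{1}(subnK Cn) exprD mulrACA mulfV ?mulr1 ?gt_eqF ?exprn_gt0 //.
by rewrite mulrC.
Qed.

End Golden.

(** * Configurations with golden growth *)

Section GoldenCriteria.
Variables (R : realType) (G : groupType) (S : {fset G}).
Hypothesis gS : generates S.
Local Notation phi := (phi R).

Lemma phiVE : phi^-1 = phi - 1.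
Proof.
have := phi2 R; have := gt_eqF (phi_gt0 R); set p := phi => /negbT p0 pp.
by apply: (mulfI p0); rewrite mulfV // mulrBr mulr1 -expr2 pp addrAC subrr add0r.
Qed.

Lemma phi_geom : phi^-1 + phi^-1 ^+ 2 = 1.
Proof.
by rewrite phiVE; have := phi2 R; set p := phi => pp; rewrite sqrrB pp; ring.
Qed.

Lemma phi_times : (phi^-1 + 1) * phi^-1 ^+ 2 = phi^-1.
Proof.
have := phi_geom; set i := phi^-1 => ii.
have -> : (i + 1) * i ^+ 2 = i * (i + i ^+ 2) by ring.
by rewrite ii mulr1.
Qed.

(** The constant [C] absorbs what it costs to finish a word. *)
Lemma golden_paths (L : eqType) (ls : seq L) (cost : L -> L -> nat)
    (v : L -> R) (M C : nat) (l0 : L) (e : seq L -> G) :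
  uniq ls -> (forall l, 0 <= v l <= 1) -> 0 < v l0 ->
  (forall l l', (cost l l' <= M)%N) ->
  (forall l, v l <= \sum_(l' <- ls | (0 < cost l l')%N)
                       v l' / phi ^+ cost l l') ->
  (forall w w', allowed cost l0 w -> allowed cost l0 w' -> e w = e w' ->
     w = w') ->
  (forall w, allowed cost l0 w -> expr_le S (weight cost l0 w + C) (e w)) ->
  golden R S.
Proof.
move=> uls v01 v0 cM vP eI eS; have pM : 0 < phi ^+ M by rewrite exprn_gt0 ?phi_gt0.
exists (v l0 / phi ^+ M, C); first by rewrite divr_gt0.
move=> n /=; rewrite mulrAC ler_pdivrMr // [leRHS]mulrC.
apply: le_trans (size_paths l0 (ltW (phi_gt1 R)) v01 cM vP (leqnn n)) _.
rewrite ler_wpM2l ?(ltW pM) //.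
rewrite ler_nat -(size_map e); apply: leq_growth => //.
  rewrite map_inj_in_uniq ?paths_uniq // => w w' /pathsP /andP[aw _].
  by move=> /pathsP /andP[aw' _]; apply: eI.
move=> g /mapP[w /pathsP /andP[aw wn] ->].
by apply: expr_leW (eS w aw); rewrite leq_add2r.
Qed.

Lemma golden_free (L : eqType) (ls : seq L) (wt : L -> nat) M (f : L -> G) :
  uniq ls -> (0 < size ls)%N -> (forall l, (0 < wt l <= M)%N) ->
  1 <= \sum_(l <- ls) phi^-1 ^+ wt l ->
  (forall l, expr_le S (wt l) (f l)) -> free_family f -> golden R S.
Proof.
case: ls => // l0 s uls _ wtM wt1 fS fF; pose cost (l l' : L) := wt l'.
apply: (@golden_paths L (l0 :: s) cost (fun=> 1) M 0 l0 (eval f)) => //.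
- by move=> _; rewrite ler01 lexx.
- by move=> l1 l; have /andP[] := wtM l.
- move=> l1; apply: le_trans wt1 _; rewrite le_eqVlt; apply/orP; left; apply/eqP.
  apply: eq_big => [l|l _]; first by have /andP[-> _] := wtM l.
  by rewrite mul1r exprVn.
- by move=> w w' _ _; apply: fF.
move=> w; rewrite addn0; elim: w l0 {uls wt1} => [|l w IH] l0 /=.
  by rewrite eval_nil => _; apply: expr_le_one.
by move=> /andP[_ /IH ew]; rewrite eval_cons; apply: expr_leM.
Qed.

Lemma golden_duo a b : expr_le S 1 a -> expr_le S 2 b ->
  free_family (duo a b) -> golden R S.
Proof.
move=> aS bS;
apply: (@golden_free _ [:: true; false] (fun l => if l then 1 else 2)%N 2) => //.
- by case.
- by rewrite !big_cons big_nil addr0 phi_geom.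
- by case.
Qed.

Lemma golden_tri a b c : expr_le S 2 a -> expr_le S 2 b -> expr_le S 3 c ->
  free_family (tri a b c) -> golden R S.
Proof.
move=> aS bS cS.
apply: (@golden_free _ [:: Some true; Some false; None]
                       (fun l => if l is None then 3 else 2)%N 3) => //.
- by case.
- rewrite !big_cons big_nil addr0; have := phi_geom; set i := phi^-1 => ii.
  rewrite le_eqVlt; apply/orP; left; apply/eqP.
  have -> : i ^+ 2 + (i ^+ 2 + i ^+ 3) = i ^+ 2 + i * (i + i ^+ 2) by ring.
  by rewrite ii mulr1 addrC.
- by case=> [[]|].
Qed.

(** The letters are the four products of one of two elements of lengths 1
    and 2 with another such element. *)
Lemma golden_pairs (f : bool * bool -> G) :
  (forall i j, expr_le S ((~~ i).+1 + (~~ j).+1) (f (i, j))) ->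
  free_family f -> golden R S.
Proof.
move=> fS; pose ls := [:: (true, true); (true, false); (false, true); (false, false)].
apply: (@golden_free _ ls (fun l => (~~ l.1).+1 + (~~ l.2).+1)%N 4) => //.
- by case=> [[] []].
- rewrite /ls !big_cons big_nil addr0 /=.
  have := phi_geom; set i := phi^-1 => ii.
  rewrite le_eqVlt; apply/orP; left; apply/eqP.
  have -> : i ^+ 2 + (i ^+ 3 + (i ^+ 3 + i ^+ 4)) = (i + i ^+ 2) * (i + i ^+ 2).
    by ring.
  by rewrite ii mulr1.
- by case.
Qed.

(** A word in [s] and its twisted copy [t s^-1 t] is spelled by keeping track of
    whether the current position is inside a pair of [t]'s; only a change of
    letter costs an extra [t]. *)
Lemma golden_switch s t : (t * t = 1)%g -> expr_le S 1 s -> expr_le S 1 t ->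
  free_family (duo s (t * s^-1 * t)%g) -> golden R S.
Proof.
move=> tt sS tS fF; pose cost (l l' : bool) := if l == l' then 1%N else 2%N.
apply: (@golden_paths _ [:: true; false] cost (fun=> 1) 2 1 true
   (eval (duo s (t * s^-1 * t)%g))) => //.
- by move=> _; rewrite ler01 lexx.
- by move=> [] [].
- have g := phi_geom.
  by case; rewrite !big_cons big_nil /= addr0 !mul1r expr1 -exprVn ?g // addrC g.
- by move=> w w' _ _; apply: fF.
pose T (l : bool) : G := if l then 1%g else t.
have TT l : (T l * T l)%g = 1%g by case: l; rewrite /= ?mulg1.
have T1 l l' : expr_le S (cost l l' - 1) (T l * T l')%g.
  by case: l l' => [] [] /=; rewrite ?mulg1 ?mul1g ?tt //; apply: expr_le_one.
have key w : forall l, expr_le S (weight cost l w + 1)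
                      (T l * eval (duo s (t * s^-1 * t)%g) w)%g.
  elim: w => [|l' w IH] l /=.
    rewrite eval_nil mulg1; case: l => //=; exact: expr_le_one.
  rewrite eval_cons.
  have -> : (T l * (duo s (t * s^-1 * t) l' * eval (duo s (t * s^-1 * t)) w) =
    T l * T l' * (if l' then s else s^-1) * (T l' * eval (duo s (t * s^-1 * t)) w))%g.
    by case: l' => /=; rewrite ?mulg1 ?mul1g !mulgA.
  have -> : (cost l l' + weight cost l' w + 1 =
             cost l l' - 1 + 1 + (weight cost l' w + 1))%N.
    by rewrite subnK ?addnA //; case: (l) (l') => [] [].
  apply: expr_leM => //; apply: expr_leM => //.
  by case: (l') => //; apply: expr_leV.
by move=> w _; have := key w true; rewrite mul1g.
Qed.

Lemma two_letters_run (W : seq bool) : true \in W -> false \in W ->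
  exists f i W', W = nseq i.+1 f ++ ~~ f :: W'.
Proof.
case: W => // f W tW fW; exists f.
have : ~~ f \in W by move: tW fW; rewrite !in_cons; case: f.
elim: W {tW fW} => // g W IH; rewrite in_cons.
have [->|gf] := eqVneq g (~~ f); first by exists 0%N, W.
move=> /= /IH[i [W' e]]; exists i.+1, W'.
have -> : g = f by move: gf; case: (g); case: (f).
by rewrite e.
Qed.

(** In the redundant case, words in the three letters that avoid one factor of
    length 2 have different values, and there are Fibonacci many of them. *)
Lemma golden_semifree a b c : expr_le S 2 a -> expr_le S 2 b -> expr_le S 2 c ->
  semifree a b c -> golden R S.
Proof.
move=> aS bS cS [fF|[fF [W [tW fW eW]]]].
  by apply: golden_tri fF => //; apply: expr_leW cS.
have [f [i [W' WE]]] := two_letters_run tW fW.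
pose cost x y := if avoids f x y then 2%N else 0%N.
(* [Some f] has fewer successors than the other letters. *)
pose v x : R := if x == Some f then phi^-1 else 1.
have p1 := phi_gt1 R; have p0 := phi_gt0 R.
have i01 : 0 <= phi^-1 <= 1 by rewrite invr_ge0 invf_le1 ?(ltW p1) ?(ltW p0).
have cost2 x w : allowed cost x w -> path (avoids f) x w.
  by elim: w x => //= y w IH x; rewrite /cost; case: ifP => //= _ /IH.
apply: (@golden_paths _ [:: Some f; Some (~~ f); None] cost v 2 0 None
  (eval (tri a b c))) => //.
- by case: (f).
- by move=> x; rewrite /v; case: ifP => // _; rewrite ler01 lexx.
- by move=> x y; rewrite /cost; case: ifP.
- have g := phi_geom; have f1 : (Some (~~ f) == Some f) = false by case: (f).
  have f2 : (Some f == Some (~~ f)) = false by case: (f).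
  move=> x; rewrite !big_cons big_nil addr0 /v /cost /avoids !eqxx f1 f2 /=.
  case: (x == Some f) => /=; rewrite -!exprVn.
    rewrite le_eqVlt; apply/orP; left; apply/eqP.
    by rewrite -mulrDl phi_times.
  rewrite le_eqVlt; apply/orP; left; apply/eqP.
  by rewrite addrA -mulrDl phi_times mul1r g.
- move=> w w' /cost2/path_sorted sw /cost2/path_sorted sw' e.
  apply: (with_word_inj (f := f) (i := i) (W' := W')) => //; rewrite -WE.
  apply: fF; rewrite !eval_flatten.
  have E u : eval (fun l => eval (duo a b) (with_word W l)) u = eval (tri a b c) u.
    by apply: eval_ext => -[l|]; rewrite ?eW //= eval_cons eval_nil mulg1.
  by rewrite !E.
move=> w; rewrite addn0; elim: w None => [|l w IH] x /=.
  by rewrite eval_nil => _; apply: expr_le_one.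
move=> /andP[c0 /IH ew]; rewrite eval_cons; apply: expr_leM => //.
by move: c0; rewrite /cost; case: ifP => // _ _; case: (l) => [[]|].
Qed.

End GoldenCriteria.

Local Close Scope ring_scope.
Local Open Scope group_scope.

(** * Conjugate generating sets *)

Section ConjugateSets.
Variables (R : realType) (G : groupType).
Implicit Types (S : {fset G}) (g h x : G).

Definition conj_set h S : {fset G} := [fset (h * x * h^-1)%g | x in S]%fset.

Lemma mem_conj_set h S x : x \in S -> h * x * h^-1 \in conj_set h S.
Proof. by move=> xS; apply/imfsetP; exists x. Qed.

Lemma conj_setK h S : conj_set h^-1 (conj_set h S) = S.
Proof.
have cV x : h^-1 * (h * x * h^-1) * h^-1^-1 = x.
  by rewrite invgK !mulgA mulVg mul1g mulgVK.
apply/fsetP => x; apply/imfsetP/idP => [[y /imfsetP[z zS ->] ->]|xS].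
  by rewrite cV.
by exists (h * x * h^-1); rewrite ?cV //; apply: mem_conj_set.
Qed.

Lemma expr_le_conj h S n g :
  expr_le S n g -> expr_le (conj_set h S) n (h * g * h^-1).
Proof.
move=> [m mn [s [ss sS ->]]]; exists m => //.
exists [seq h * x * h^-1 | x <- s]; split; first by rewrite size_map.
  move=> _ /mapP[x /sS xS ->]; rewrite conj_inv.
  by case: xS => /(mem_conj_set h); [left|right].
elim: s {ss sS} => [|x s IH] /=; first by rewrite !big_nil mulg1 mulgV.
by rewrite !big_cons -IH conj_mul.
Qed.

Lemma generates_conj h S : generates S -> generates (conj_set h S).
Proof.
move=> gS g; have [n e] := gS (h^-1 * g * h^-1^-1).
have : expr_le S n (h^-1 * g * h^-1^-1) by exists n.
move=> /(expr_le_conj h)[m _]; rewrite !mulgA mulgV mul1g -!mulgA.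
by rewrite invgK mulgV mulg1 => em; exists m.
Qed.

Lemma golden_conj h S : generates S -> golden R (conj_set h S) -> golden R S.
Proof.
move=> gS [kC k0 kCP]; exists kC => // n; apply: le_trans (kCP n) _.
rewrite ler_nat.
have [s [us <- sP]] := ball_enum (n + kC.2) (generates_conj h gS).
rewrite -(size_map (fun g => h^-1 * g * h^-1^-1)); apply: leq_growth => //.
  by rewrite map_inj_uniq // => x y /mulIg/mulgI.
move=> _ /mapP[g /sP gn ->]; rewrite -(conj_setK h S).
exact: expr_le_conj.
Qed.

End ConjugateSets.

(** * Generators of free products *)

Section Cases.
Variables (R : realType) (A B : groupType).
Hypotheses (hA : nontrivial_group A) (hB : nontrivial_group B).
Local Notation G := (freeprod A B).
Local Notation T := (A + B)%type.
Local Notation lt := (@freeprod_letter A B).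
Local Notation side := (@letter_side A B).
Local Notation linv := (@letter_inv A B).
Local Arguments reduced : simpl never.
Implicit Types (S : {fset G}) (g h s t X Y Z : G) (c a : T) (w y z : seq T) (o : bool).

Lemma golden_good_pair S s t : generates S -> s \in S -> t \in S ->
  good_pair s t -> golden R S.
Proof.
move=> gS sS tS [[s' [t' [es et F]]]|[tt F]].
  have e1 : expr_le S 1%N s'.
    by case: es => ->; [|apply: expr_leV]; apply: expr_le_gen.
  have e2 : expr_le S 1%N t'.
    by case: et => ->; [|apply: expr_leV]; apply: expr_le_gen.
  by apply: (golden_duo R gS e1 _ F); apply: (expr_leM e1 e2).
by apply: (golden_switch R gS tt _ _ F); apply: expr_le_gen.
Qed.

(** If all generators normalize the cyclic group of [s], the whole group does. *)
Lemma axis_or_mover S s : generates S ->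
  (forall g, g * s * g^-1 = s \/ g * s * g^-1 = s^-1) \/
  exists t, [/\ t \in S, t * s * t^-1 <> s & t * s * t^-1 <> s^-1].
Proof.
move=> gS; have [ex|nex] := pselect (exists t, [/\ t \in S, t * s * t^-1 <> s
    & t * s * t^-1 <> s^-1]); [by right|left].
pose P g := g * s * g^-1 = s \/ g * s * g^-1 = s^-1.
apply: (gen_ind gS (P := P)); first by left; rewrite mul1g invg1 mulg1.
  move=> g h; rewrite /P invgM => Pg Ph.
  have -> : g * h * s * (h^-1 * g^-1) = g * (h * s * h^-1) * g^-1 by rewrite !mulgA.
  case: Ph => -> //; rewrite -conj_inv.
  by case: Pg => ->; rewrite ?invgK; [right|left].
move=> g gS'; have Pg : P g.
  have [e|e] := pselect (g * s * g^-1 = s); first by left.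
  have [e'|e'] := pselect (g * s * g^-1 = s^-1); first by right.
  by case: nex; exists g.
split=> //; rewrite /P invgK; case: Pg => e; [left|right].
  by rewrite -[in LHS]e !mulgA mulVg mul1g mulgVK.
by apply: invg_inj; rewrite invgK !invgM invgK -e !mulgA mulVg mul1g mulgVK.
Qed.

(** A conjugate of [s] is cyclically reduced, so its axis contains the base edge. *)
Lemma golden_hyperbolic S s : generates S -> s \in S -> hyperbolic s ->
  ~ isomorphic_groups G (freeprod C2 C2) -> golden R S.
Proof.
move=> gS sS [h hs] h22; apply: (@golden_conj _ _ h) => //.
move: (generates_conj h gS) (mem_conj_set h sS) hs.
move: (conj_set h S) (h * s * h^-1) => {gS sS}S {}s gS sS /andP[s0 se].
have [ns|[t [tS ts ts']]] := axis_or_mover s gS; last first.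
  apply: (golden_good_pair gS sS tS (hyperbolic_good s0 se _ ts')) => e.
  by apply: ts; rewrite e mulgK.
case: h22; have [q [ss sV]] := even_sides s0 se.
exact: normal_axis_dihedral ss sV ns.
Qed.

Lemma hyperbolic_conj h g : hyperbolic (h * g * h^-1) -> hyperbolic g.
Proof. by move=> [k hk]; exists (k * h); rewrite invgM !mulgA in hk *. Qed.

Lemma side_letter_ex o : exists c, ~~ letter_trivial c /\ side c = o.
Proof.
have [a a1] := hA; have [b b1] := hB.
by case: o; [exists (inl a)|exists (inr b)]; split=> //; apply/eqP.
Qed.

Lemma trivial_letter_ex o : exists u, side u = o /\ lt u = 1.
Proof.
by case: o; [exists (inl 1)|exists (inr 1)]; split=> //;
   apply: freeprod_letter_trivial; rewrite /= eqxx.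
Qed.

(** Otherwise [S] would lie in one of the two factors. *)
Lemma off_vertex S o : generates S ->
  exists2 Y, Y \in S & forall a, side a = o -> Y <> lt a.
Proof.
move=> gS.
have [//|nex] := pselect (exists2 Y, Y \in S & forall a, side a = o -> Y <> lt a).
have all_side : forall g, exists2 a, side a = o & g = lt a.
  have [u [uo u1]] := trivial_letter_ex o.
  apply: (gen_ind gS); first by exists u.
    move=> _ _ [a ao ->] [b bo ->].
    have ab : side a = side b by rewrite ao bo.
    by have [z [sz ez _ _ _]] := letter_merge ab; exists z; rewrite ?sz.
  move=> g gS'; have [a ao ga] : exists2 a, side a = o & g = lt a.
    have [//|na] := pselect (exists2 a, side a = o & g = lt a).
    by case: nex; exists g => // a ao ga; apply: na; exists a.
  split; first by exists a.
  by exists (linv a); rewrite ?letter_side_inv // freeprod_letterV ga.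
have [d [nd sd]] := side_letter_ex (~~ o); have [a ao e] := all_side (lt d).
by move: sd; rewrite (letter_inj nd e) ao; case: (o).
Qed.

(** The letter [a], which may be trivial, is the rotation around the base vertex
    by which the path to the vertex of [Y] starts. *)
Lemma position o Y : ~ hyperbolic Y -> (forall a, side a = o -> Y <> lt a) ->
  exists a y cy, [/\ side a = o, half (~~ o) y cy & Y = lt a * ell y cy * (lt a)^-1].
Proof.
move=> nh na; have Y1 : Y <> 1.
  have [u [uo u1]] := trivial_letter_ex o.
  by rewrite -u1; apply: na.
have [q [w [c [hw YE]]]] := elliptic_half Y1 nh.
have [qo|qo] := eqVneq q o; last first.
  have [u [uo u1]] := trivial_letter_ex o.
  exists u, w, c; split=> //; last by rewrite u1 mul1g invg1 mulg1.
  by move: qo hw; case: (o); case: (q).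
case: w hw YE => [|e w] hw YE.
  have /andP[_ /eqP sc] := hw; case: (na c); first by rewrite -qo -sc.
  by rewrite YE ell0.
have /andP[_ /eqP se] := hw; exists e, w, c; rewrite -ell_cons -qo.
by split=> //; rewrite -se; apply: (@half_drop _ _ q [::]).
Qed.

Lemma letter_conj a c : side a = side c -> exists c',
  [/\ side c' = side c, lt c' = (lt a)^-1 * lt c * lt a,
      ~~ letter_trivial c -> ~~ letter_trivial c'
    & ~~ letter_trivial c -> linv c <> c -> linv c' <> c'].
Proof.
move=> sa; have [z [sz ez _ _ _]] := letter_merge (esym sa).
have az : side (linv a) = side z by rewrite letter_side_inv sz sa.
have [z' [sz' ez' _ _ _]] := letter_merge az.
have e : lt z' = (lt a)^-1 * lt c * lt a.
  by rewrite -ez' -ez freeprod_letterV mulgA.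
have eV : lt c = lt a * lt z' * (lt a)^-1 by rewrite e !mulgA mulgV mul1g mulgK.
have nt : ~~ letter_trivial c -> ~~ letter_trivial z'.
  move=> nc; apply/negP => /freeprod_letter_trivial e1.
  by apply: (start_neq1 (start_letter nc)); rewrite eV e1 mulg1 mulgV.
exists z'; split=> //; first by rewrite sz' letter_side_inv.
move=> nc cc zz; apply: cc; apply: esym; apply: (letter_inj nc).
by rewrite freeprod_letterV eV conj_inv -(freeprod_letterV z') zz.
Qed.

(** The base edge is placed at the vertex of [X], on the path to the vertex of
    another generator. *)
Lemma normal_form S X : generates S -> (forall s, s \in S -> ~ hyperbolic s) ->
  X \in S -> X <> 1 -> exists h c Y y cy,
    [/\ ~~ letter_trivial c, half (~~ side c) y cy, Y \in S,
        h * X * h^-1 = lt c & h * Y * h^-1 = ell y cy].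
Proof.
move=> gS nh XS X1; have [q [w [c [hw XE]]]] := elliptic_half X1 (nh X XS).
have nc := half_nontrivial hw.
have [Y YS nY] := off_vertex (side c) (generates_conj (elt w)^-1 gS).
have /imfsetP[Y0 Y0S YE] := YS.
have nhY : ~ hyperbolic Y by rewrite YE => /hyperbolic_conj; apply: nh.
have [a [y [cy [sa hy EY]]]] := position nhY nY.
have [c' [sc' ec' ntc _]] := letter_conj sa; have nc' := ntc nc.
exists ((lt a)^-1 * (elt w)^-1), c', Y0, y, cy; rewrite sc'; split=> //.
  by rewrite XE ec' /ell !invgM !invgK !mulgA !mulgVK.
rewrite invgM -[ell y cy](mulKg (lt a)) -[_ * ell _ _](mulgK (lt a)^-1).
by rewrite -EY YE invgK !mulgA.
Qed.

Lemma start_ellVV o w c : half o w c -> start o (ell w c)^-1^-1.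
Proof. by move=> hw; rewrite invgK; apply: start_ell. Qed.

(** Different letters of one factor move the half-tree in front of [Y] to
    disjoint half-trees. *)
Lemma golden_three_letters S c1 c2 c3 o y cy : generates S ->
  side c1 = o -> side c2 = o -> side c3 = o ->
  ~~ letter_trivial c1 -> ~~ letter_trivial c2 -> ~~ letter_trivial c3 ->
  c1 <> c2 -> c1 <> c3 -> c2 <> c3 -> half (~~ o) y cy ->
  expr_le S 1%N (lt c1) -> expr_le S 1%N (lt c2) -> expr_le S 2%N (lt c3) ->
  expr_le S 1%N (ell y cy) -> golden R S.
Proof.
move=> gS s1 s2 s3 n1 n2 n3 d12 d13 d23 hy e1 e2 e3 eY.
pose c (l : option bool) :=
  match l with Some true => c1 | Some false => c2 | None => c3 end.
have F := @free_diverging _ _ (option bool) o (fun=> [::]) c (ell y cy) None.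
have dv a b : a <> b -> diverging [::] a [::] b.
  move=> ab [//|x s]; rewrite !prefix_cons => /andP[/eqP ax _] /andP[/eqP bx _].
  by apply: ab; rewrite ax bx.
apply: (golden_tri R gS (expr_leM e1 eY) (expr_leM e2 eY) (expr_leM e3 eY)).
apply: (free_reindex (p := id)) (F _ _ _ _ _) => //.
- by case=> [[]|]; rewrite ell0.
- by case=> [b|]; [exists None|exists (Some true)].
- by case=> [[]|] /=; rewrite -?s1 -?s2 -?s3; [|rewrite s1 -s2|rewrite s1 -s3];
     apply: half_letter.
- case=> [[]|] [[]|] //= _; apply: dv => //; exact: nesym.
- exact: start_ell hy.
- exact: start_ellV hy.
Qed.

(** With the letter [c] between [Y] and [Z], the gaps between alternating
    occurrences of [Y] and [Z] can be filled with two different letters each: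
    multiplying by [c] or by its inverse, or by nothing. *)
Lemma golden_between S c a y cy z cz : generates S ->
  ~~ letter_trivial c -> linv c <> c -> ~~ letter_trivial a -> side a = side c ->
  half (~~ side c) y cy -> half (~~ side c) z cz ->
  expr_le S 1%N (lt c) -> expr_le S 1%N (ell y cy) ->
  expr_le S 1%N (lt a * ell z cz * (lt a)^-1) -> golden R S.
Proof.
move=> gS nc cc na sa hy hz eX eY eZ.
have choice b : exists e, [/\ side e = side c, ~~ letter_trivial e,
    expr_le S 1%N (lt e) & e <> b].
  have [eb|eb] := eqVneq c b.
    exists (linv c); rewrite letter_side_inv letter_trivial_inv; split=> //.
      by rewrite freeprod_letterV; apply: expr_leV.
    by rewrite -eb.
  by exists c; split=> //; apply/eqP.
have [e [se ne ee ea]] := choice (linv a).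
have [e' [se' ne' ee' ea']] := choice a.
have sea : side e = side a by rewrite se.
have [u [su eu tu ua _]] := letter_merge sea.
have sae : side (linv a) = side e' by rewrite letter_side_inv sa.
have [u' [su' eu' tu' _ ua']] := letter_merge sae.
have nu : ~~ letter_trivial u by apply/negP => /tu.
have nu' : ~~ letter_trivial u'.
  by apply/negP => /tu' /(inv_inj (@letter_invK A B)) /esym.
have uNa : u <> a by move/ua => te; rewrite te in ne.
have uNa' : u' <> linv a by move/ua' => te; rewrite te in ne'.
pose C (i : bool) := if i then a else u; pose D (i : bool) := if i then linv a else u'.
have sC i : side (C i) = side c by case: i => //=; rewrite su.
have sD i : side (D i) = side c by case: i => //=; rewrite ?su' letter_side_inv.
have nC i : ~~ letter_trivial (C i) by case: i.
have nD i : ~~ letter_trivial (D i) by case: i; rewrite /= ?letter_trivial_inv.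
have CI : injective C by case=> [] [] //= e0; case: uNa; rewrite e0.
have DI : injective D by case=> [] [] //= e0; case: uNa'; rewrite e0.
pose Y := ell y cy; pose Z := ell z cz.
pose f (p : bool * bool) : G := Y * lt (C p.1) * Z * lt (D p.2).
apply: (@golden_pairs R _ S gS f) => [i j|].
  have -> : f (i, j) = Y * (if i then 1 else lt e) *
      ((lt a * Z * (lt a)^-1) * (if j then 1 else lt e')).
    rewrite /f /C /D; case: i; case: j => /=;
      rewrite -?eu -?eu' ?freeprod_letterV ?mulg1 !mulgA //.
  have e01 (i0 : bool) x : expr_le S 1%N x -> expr_le S (~~ i0) (if i0 then 1 else x).
    by move=> ex; case: i0 => //=; apply: expr_le_one.
  rewrite -[(~~ i).+1]add1n -[(~~ j).+1]add1n.
  by apply: expr_leM; apply: expr_leM => //; apply: e01.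
have vl b h : side b = side c -> ~~ letter_trivial b -> start (~~ side c) h ->
    val (lt b * h) = b :: val h.
  move=> sb nb /start_flip; rewrite negbK -sb => nh.
  by rewrite (val_mul (start_letterV nb)) ?val_letter.
have sl b h : side b = side c -> ~~ letter_trivial b -> start (~~ side c) h ->
    ~~ start (~~ side c) (lt b * h).
  by move=> sb nb sh; rewrite /start vl //= sb; case: (side c).
have sY h : ~~ start (~~ side c) h -> start (~~ side c) (Y * h).
  exact: start_mul (start_ellV hy) (start_ell hy).
have sZ h : ~~ start (~~ side c) h -> start (~~ side c) (Z * h).
  exact: start_mul (start_ellV hz) (start_ell hz).
have sY0 : start (~~ side c) Y by apply: start_ell.
clearbody Y Z; apply: (@ping_pong _ _ _ (start (~~ side c))).
- by exists Y.
- by move=> [i j]; exists (~~ i, j); case: i.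
- move=> [i j] h sh; rewrite /f -!mulgA.
  by apply: sY; apply: (sl) => //; apply: sZ; apply: (sl).
move=> [i j] [i' j'] h h' sh sh'; rewrite /f -!mulgA /= => /mulgI /(congr1 val).
have sZh := sZ _ (sl _ _ (sD j) (nD j) sh).
have sZh' := sZ _ (sl _ _ (sD j') (nD j') sh').
rewrite !vl // => e1; have ci := CI _ _ (congr1 (head a) e1).
have /mulgI/(congr1 val) := val_inj (congr1 behead e1).
by rewrite !vl // => /(congr1 (head a)) /= /DI ->; rewrite ci.
Qed.

Lemma ell_square1 w c : ~~ letter_trivial c -> ell w c * ell w c = 1 -> linv c = c.
Proof.
move=> nc; rewrite /ell conj_mul => /(canRL (mulgK _)); rewrite mul1g invgK.
move=> e; have : lt c * lt c = 1.
  by apply: (@mulgI _ (elt w)); rewrite mulg1.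
move=> /mulg1_eq cV; apply: esym; apply: (letter_inj nc).
by rewrite freeprod_letterV cV.
Qed.

(** [X Z], [X^-1 Z] and [X Z^-1] are free, because neither [X] nor [Z] equals its
    inverse. *)
Lemma golden_two_rotations S c a z cz : generates S ->
  ~~ letter_trivial c -> linv c <> c -> side a = side c ->
  half (~~ side c) z cz -> linv cz <> cz ->
  expr_le S 1%N (lt c) ->
  expr_le S 1%N (lt a * ell z cz * (lt a)^-1) -> golden R S.
Proof.
move=> gS nc cc sa hz czz eX eZ.
have [c' [sc' ec' nc' cc']] := letter_conj sa.
pose X := lt c; pose Z := lt a * ell z cz * (lt a)^-1.
have F : free_family (tri (lt c' * ell z cz) ((lt c')^-1 * ell z cz)
                          (lt c' * ell z (linv cz))).
  apply: free_at_vertex; rewrite ?sc' //.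
  - exact: nc'.
  - exact: cc'.
  - exact: half_inv.
  - exact: diverging_inv.
have eXV := expr_leV eX; have eZV := expr_leV eZ.
apply: (golden_tri R gS (expr_leM eX eZ) (expr_leM eXV eZ)
                        (expr_leW _ (expr_leM eX eZV))) => //.
have eV : lt c = lt a * lt c' * (lt a)^-1 by rewrite ec' !mulgA mulgV mul1g mulgK.
apply: (free_tri_conj (h := lt a) F); rewrite eV.
- by rewrite conj_mul.
- by rewrite conj_inv conj_mul.
- by rewrite conj_inv conj_mul ellV.
Qed.

(** If the half of one involution continues that of the other, it is folded by the
    latter, and [mixed_triple] applies at the vertex of the latter. *)
Lemma golden_rotation S c y cy z cz : generates S ->
  ~~ letter_trivial c -> linv c <> c ->
  half (~~ side c) y cy -> linv cy = cy ->
  half (~~ side c) z cz -> linv cz = cz -> ell y cy <> ell z cz ->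
  expr_le S 1%N (lt c) -> expr_le S 1%N (ell y cy) -> expr_le S 1%N (ell z cz) ->
  golden R S.
Proof.
move=> gS nc cc hy yy hz zz yz eX eY eZ; have eXV := expr_leV eX.
have hc : half (~~ ~~ side c) [::] c by rewrite negbK; apply: half_letter.
have fold w v cw cv r : half (~~ side c) w cw -> half (~~ side c) v cv ->
    linv cw = cw -> linv cv = cv ->
    expr_le S 1%N (ell w cw) -> expr_le S 1%N (ell v cv) ->
    v = w ++ cw :: r -> golden R S.
  move=> hw hv ww vv eW eV E.
  have F : semifree (ell (word_inv w ++ [::]) c * ell [::] cw)
     ((ell (word_inv w ++ [::]) c)^-1 * ell [::] cw) (ell r cv * ell [::] cw).
    apply: (@mixed_triple _ _ _ (~~ side cw) _ _ _ _ _ _ (ltnSn _)) => //.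
    - by rewrite negbK; apply: half_letter; apply: half_nontrivial hw.
    - exact: half_shift hw hc.
    - by apply: (@half_drop _ _ (~~ side c) w); rewrite -E.
  pose D := lt cw; have DD : D * D = 1 by rewrite /D -ell0; apply: ell_involution.
  have XE : lt c = elt w * ell (word_inv w ++ [::]) c * (elt w)^-1.
    by rewrite -ell0; apply: ell_unshift.
  have WE : ell w cw = elt w * D * (elt w)^-1 by [].
  have VE : ell v cv = elt w * (D * ell r cv * D) * (elt w)^-1.
    by rewrite E ell_cat ell_cons (involution_inv DD).
  apply: (golden_semifree R gS (expr_leM eX eW) (expr_leM eXV eW) (expr_leM eW eV)).
  apply: (semifree_eq (semifree_conj (elt w) F)).
  - by rewrite XE WE ell0 conj_mul.
  - by rewrite XE WE ell0 conj_inv conj_mul.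
  - by rewrite WE VE ell0 conj_mul !mulgA (involution_cancel DD).
have [[e ec]|[r E]|[r E]|dv] := half_cases y cy z cz.
- by case: yz; rewrite e ec.
- exact: fold hy hz yy zz eY eZ E.
- exact: fold hz hy zz yy eZ eY E.
apply: (golden_tri R gS (expr_leM eX eY) (expr_leM eXV eY)
                        (expr_leW _ (expr_leM eX eZ))) => //.
exact: free_at_vertex.
Qed.

(** Unless [S] has golden growth, [c] has order 3 and is up to inversion the only
    generator with its vertex, and there is no other generator besides one
    involution. *)
Lemma golden_with_rotation S c y cy : generates S ->
  (forall s, s \in S -> ~ hyperbolic s) ->
  ~~ letter_trivial c -> linv c <> c -> half (~~ side c) y cy ->
  lt c \in S -> ell y cy \in S ->
  ~ isomorphic_groups G (freeprod C2 C3) -> golden R S.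
Proof.
move=> gS nh nc cc hy XS YS h23.
have eX := expr_le_gen XS; have eY := expr_le_gen YS; have eXV := expr_leV eX.
have [//|ng] := pselect (golden R S).
have u1 := trivial_letter_ex (side c).
have vertex a : lt a \in S -> side a = side c -> ~~ letter_trivial a ->
    a = c \/ a = linv c.
  move=> aS sa na; have [->|/eqP ac] := eqVneq a c; first by left.
  have [->|/eqP ac'] := eqVneq a (linv c); first by right.
  have sca : side c = side a by [].
  have [u [su eu tu ua uc]] := letter_merge sca.
  case: ng; apply: (@golden_three_letters S c a u (side c) y cy) => //.
  - by apply/negP => /tu ca; apply: ac'; rewrite ca letter_invK.
  - by move=> ca; apply: ac.
  - by move=> cu; have := uc (esym cu); rewrite (negbTE na).
  - by move=> au; have := ua (esym au); rewrite (negbTE nc).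
  - exact: expr_le_gen.
  - by rewrite -eu; apply: expr_leM eX (expr_le_gen aS).
have order3 : lt c * lt c * lt c = 1.
  have [u [su eu tu ua uc]] := letter_merge (erefl (side c)).
  have [ucV|/eqP ucV] := eqVneq u (linv c).
    by rewrite eu ucV freeprod_letterV mulVg.
  case: ng; apply: (@golden_three_letters S c (linv c) u (side c) y cy) => //.
  - by rewrite letter_side_inv.
  - by rewrite letter_trivial_inv.
  - by apply/negP => /tu /esym.
  - exact: nesym.
  - by move=> cu; have := uc (esym cu); rewrite (negbTE nc).
  - exact: nesym.
  - by rewrite freeprod_letterV.
  - by rewrite -eu; apply: (expr_leM eX eX).
have off Z : Z \in S -> (forall a, side a = side c -> Z <> lt a) -> Z = ell y cy.
  move=> ZS nZ; have [a [z [cz [sa hz EZ]]]] := position (nh Z ZS) nZ.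
  have eZ := expr_le_gen ZS.
  have [zz|/eqP zz] := eqVneq (linv cz) cz; last first.
    by case: ng; rewrite EZ in eZ; apply: (golden_two_rotations gS nc cc sa hz zz eX eZ).
  have [yy|/eqP yy] := eqVneq (linv cy) cy; last first.
    case: ng; have [u [su e1]] := u1.
    apply: (golden_two_rotations gS nc cc su hy yy eX).
    by rewrite e1 mul1g invg1 mulg1.
  have [ta|na] := boolP (letter_trivial a); last first.
    by case: ng; rewrite EZ in eZ; apply: (golden_between gS nc cc na sa hy hz).
  rewrite freeprod_letter_trivial // mul1g invg1 mulg1 in EZ.
  have [//|/eqP yz] := eqVneq Z (ell y cy).
  case: ng; rewrite EZ in eZ yz.
  by apply: (golden_rotation gS nc cc hy yy hz zz _ eX eY eZ) => /esym.
have yy : linv cy = cy.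
  have [//|/eqP yy] := eqVneq (linv cy) cy.
  case: ng; have [u [su e1]] := u1.
  apply: (golden_two_rotations gS nc cc su hy yy eX).
  by rewrite e1 mul1g invg1 mulg1.
case: h23; have [f fP] := C2_morphism (ell_involution y yy).
have [g gP] := C3_morphism order3.
have i2 : (1 : 'Z_2)%R <> 1 :> C2 by [].
have i3 : (1 : 'Z_3)%R <> 1 :> C3 by [].
apply: (@freeprod_iso _ _ _ _ f g (~~ side c)).
- by move=> i /fP->; split; [apply: start_ell|apply: start_ellV].
- move=> i /gP[]->; rewrite negbK; split; rewrite ?invgK;
    by [apply: start_letter|apply: start_letterV].
move=> P P1 PM Pf Pg; have PY : P (ell y cy) by rewrite -(fP _ i2).
have [PX PXV] : P (lt c) /\ P (lt c)^-1.
  have g1 : g 1 = 1 by apply: (@mulgI _ (g 1)); rewrite -gmulfM !mulg1.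
  have gV i : P (g i)^-1.
    have -> : (g i)^-1 = g i^-1 by apply: mulg1_eq; rewrite -gmulfM mulgV.
    exact: Pg.
  by have [e|e] := gP _ i3; have := Pg (1 : 'Z_3)%R; have := gV (1 : 'Z_3)%R;
     rewrite e ?invgK.
apply: (gen_ind gS P1 PM) => Z ZS.
have [[a sa Za]|nv] := pselect (exists2 a, side a = side c & Z = lt a); last first.
  rewrite (off Z ZS); last by move=> a sa Za; apply: nv; exists a.
  by split=> //; rewrite (involution_inv (ell_involution y yy)).
have [ta|na] := boolP (letter_trivial a).
  by rewrite Za freeprod_letter_trivial // invg1.
rewrite Za in ZS *.
by have [->|->] := vertex a ZS sa na; rewrite ?freeprod_letterV ?invgK.
Qed.

(** The product of the first two involutions is hyperbolic; a third generator that
    moves its axis completes a triple for [involutive_triple]. *)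
Lemma golden_involutions S c y cy : generates S ->
  (forall s, s \in S -> ~ hyperbolic s) -> (forall s, s \in S -> s * s = 1) ->
  ~~ letter_trivial c -> half (~~ side c) y cy ->
  lt c \in S -> ell y cy \in S ->
  ~ isomorphic_groups G (freeprod C2 C2) -> golden R S.
Proof.
move=> gS nh inv nc hy XS YS h22.
have eX := expr_le_gen XS; have eY := expr_le_gen YS.
have cc : linv c = c by apply: (@ell_square1 [::]); rewrite ?ell0 //; apply: inv.
have yy : linv cy = cy by apply: (@ell_square1 y); [apply: half_nontrivial hy|apply: inv].
pose X := lt c; pose Y := ell y cy; pose s := X * Y.
have XX : X * X = 1 by apply: inv.
have YY : Y * Y = 1 by apply: inv.
have ss : start (side c) s.
  apply: start_mul (start_letterV nc) (start_letter nc) _.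
  by have := start_flip (start_ell hy); rewrite negbK.
have sV : start (~~ side c) s^-1.
  rewrite /s invgM; apply: (start_mul (start_ellVV hy) (start_ellV hy)).
  exact: start_flip (start_letterV nc).
have [ns|[Z [ZS Z1 Z2]]] := axis_or_mover s gS.
  by case: h22; apply: normal_axis_dihedral ss sV ns.
have eZ := expr_le_gen ZS; have ZZ := inv Z ZS.
have Zn1 : Z <> 1 by move=> Ze; apply: Z1; rewrite Ze mul1g invg1 mulg1.
have [q [z [cz [hz ZE]]]] := elliptic_half Zn1 (nh Z ZS).
have zz : linv cz = cz.
  by apply: (@ell_square1 z); [apply: half_nontrivial hz|rewrite -ZE].
have key : s^-1 * Z <> Z * s.
  by move=> e; apply: Z2; rewrite -e mulgK.
have sVE : s^-1 = Y * X by rewrite /s invgM (involution_inv XX) (involution_inv YY).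
have hc := half_letter nc.
have [qc|qc] := eqVneq q (side c).
  rewrite qc in hz; have F := @involutive_triple _ _ _ (side c) y cy [::] c z cz (ltnSn _)
    hy hc hz yy cc zz.
  apply: (golden_tri R gS (expr_leM eX eY) (expr_leM eZ eY)
                          (expr_leM (expr_leM eX eZ) eY)).
  rewrite ZE -[lt c]ell0; apply: F; rewrite ell0 -ZE -/X -/Y => e; apply: key.
  by rewrite sVE; apply: commute_reflected_inv.
have {}qc : q = ~~ side c by move: qc; case: (q); case: (side c).
rewrite qc in hz; have hc' : half (~~ ~~ side c) [::] c by rewrite negbK.
have F := @involutive_triple _ _ _ (~~ side c) [::] c y cy z cz (ltnSn _)
  hc' hy hz cc yy zz.
apply: (golden_tri R gS (expr_leM eY eX) (expr_leM eZ eX) (expr_leM (expr_leM eY eZ) eX)).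
rewrite ZE -[lt c]ell0; apply: F; rewrite ell0 -ZE -/X -/Y => e; apply: key.
by rewrite sVE; apply: commute_reflected.
Qed.

Lemma golden_generating_set S : generates S ->
  ~ isomorphic_groups G (freeprod C2 C2) ->
  ~ isomorphic_groups G (freeprod C2 C3) -> golden R S.
Proof.
move=> gS h22 h23.
have [[s sS hs]|nh] := pselect (exists2 s, s \in S & hyperbolic s).
  exact: golden_hyperbolic gS sS hs h22.
have {}nh s : s \in S -> ~ hyperbolic s by move=> sS hs; apply: nh; exists s.
have nhc h s : s \in conj_set h S -> ~ hyperbolic s.
  by move=> /imfsetP[x xS ->] /hyperbolic_conj; apply: nh.
have [[X XS X2]|inv] := pselect (exists2 X, X \in S & X * X <> 1).
  have X1 : X <> 1 by move=> X1; apply: X2; rewrite X1 mulg1.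
  have [h [c [Y [y [cy [nc hy YS EX EY]]]]]] := normal_form gS nh XS X1.
  apply: (@golden_conj _ _ h) => //.
  apply: (@golden_with_rotation _ c y cy) => //; rewrite -?EX -?EY.
  - exact: generates_conj.
  - exact: nhc.
  - move=> cc; apply: X2; apply: (@mulgI _ h); apply: (@mulIg _ h^-1).
    rewrite -conj_mul EX mulg1 mulgV -[in X in X * _]cc freeprod_letterV mulVg //.
  - exact: mem_conj_set.
  - exact: mem_conj_set.
have {}inv s : s \in S -> s * s = 1.
  by move=> sS; have [//|n1] := pselect (s * s = 1); case: inv; exists s.
have [X XS nX] := off_vertex true gS.
have X1 : X <> 1.
  by rewrite -(@freeprod_letter_trivial A B (inl 1)) //=; apply: nX.
have [h [c [Y [y [cy [nc hy YS EX EY]]]]]] := normal_form gS nh XS X1.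
apply: (@golden_conj _ _ h) => //.
apply: (@golden_involutions _ c y cy) => //; rewrite -?EX -?EY.
- exact: generates_conj.
- exact: nhc.
- by move=> s /imfsetP[x xS ->]; rewrite conj_mul inv // mulg1 mulgV.
- exact: mem_conj_set.
- exact: mem_conj_set.
Qed.

End Cases.

Local Close Scope group_scope.
Local Open Scope ring_scope.

Theorem theorem1 (R : realType) (A B : groupType)
  (hA : nontrivial_group A) (hB : nontrivial_group B)
  (hG : finitely_generated (freeprod A B))
  (h22 : ~ isomorphic_groups (freeprod A B) (freeprod C2 C2))
  (h23 : ~ isomorphic_groups (freeprod A B) (freeprod C2 C3)) :
  (1 + Num.sqrt 5) / 2 <= minimal_growth_rate R (freeprod A B).
Proof.
have [S gS] := hG; apply: lb_le_inf; first by exists (growth_rate R S), S.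
move=> _ [S' gS' <-]; apply: growth_rate_golden => //.
exact: golden_generating_set.
Qed.
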